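(* Let $\mu=e^{-V}dx$ be a probability distribution on $\mathbb{R}^d$ with $V\in\mathcal{C}^2(\mathbb{R}^d)$, and let $C_{Lip,Lip}\in(0,\infty]$ be as in the context. Then for all functions $f:\mathbb{R}^d\to\mathbb{R}_+$ (weakly differentiable) with $\int f\,d\mu=1$, \[ W_1(\mu,f\mu)\le C_{Lip,Lip}\int_{\mathbb{R}^d}|\nabla f|\,d\mu . \]
   Context: $\mathcal{L}f=\Delta f-\nabla V\cdot\nabla f$. $C_{Lip,Lip}$ is a constant such that for every Lipschitz function $g:\mathbb{R}^d\to\mathbb{R}$ there exists a Lipschitz function $f$ solving $\mathcal{L}f=g-\int g\,d\mu$ (weakly) with $\|\nabla f\|_\infty\le C_{Lip,Lip}\|\nabla g\|_\infty$; if no finite such constant exists, $C_{Lip,Lip}=\infty$ and the inequality is empty. $W_1(\alpha,\beta)=\sup\{\int h\,d\alpha-\int h\,d\beta : \|\nabla h\|_\infty\le1\}$ is the $L^1$-Kantorovich–Wasserstein distance. *)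

(* Defs.v *)
(* R^d is modelled as [d.-tuple R] with the
   library's product (= Borel) sigma-algebra; calculus on R^d is expressed
   through coordinate-wise (one-dimensional) derivatives. *)
From HB Require Import structures.
From mathcomp Require Import all_boot all_order all_algebra.
From mathcomp Require Import all_classical all_reals all_analysis.
Set Implicit Arguments.
Unset Strict Implicit.
Unset Printing Implicit Defensive.
Import Order.TTheory GRing.Theory Num.Theory.
Import numFieldNormedType.Exports.
Local Open Scope classical_set_scope.
Local Open Scope ring_scope.

Section Defs.
Variables (R : realType) (d : nat).
Local Notation E := (d.-tuple R).

Definition vnorm (v : 'I_d -> R) : R := Num.sqrt (\sum_(i < d) v i ^+ 2).

Definition edist (x y : E) : R := vnorm (fun i => tnth x i - tnth y i).

Definition lipschitz_with (L : R) (h : E -> R) : Prop :=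
  forall x y, `|h x - h y| <= L * edist x y.

Definition shift (x : E) (i : 'I_d) (t : R) : E :=
  [tuple tnth x j + (if j == i then t else 0) | j < d].

Definition pd (i : 'I_d) (phi : E -> R) (x : E) : R :=
  derive1 (fun t : R => phi (shift x i t)) 0.

Definition pd_exists (i : 'I_d) (phi : E -> R) (x : E) : Prop :=
  derivable (fun t : R => phi (shift x i t)) 0 1.

Definition iter_pd (s : seq 'I_d) (phi : E -> R) : E -> R :=
  foldr pd phi s.

Definition econtinuous (phi : E -> R) : Prop :=
  forall x (e : R), 0 < e -> exists2 del : R, 0 < del &
    forall y, edist y x < del -> `|phi y - phi x| < e.

Definition Ck (k : nat) (phi : E -> R) : Prop :=
  forall s : seq 'I_d, (size s <= k)%N ->
    econtinuous (iter_pd s phi) /\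
    ((size s < k)%N -> forall i x, pd_exists i (iter_pd s phi) x).

Definition smooth (phi : E -> R) : Prop := forall k, Ck k phi.

Definition test_fun (phi : E -> R) : Prop :=
  smooth phi /\ exists r : R, forall x, r < vnorm (tnth x) -> phi x = 0.

Definition is_lebesgue (lam : {measure set E -> \bar R}) : Prop :=
  forall a b : 'I_d -> R, (forall i, a i <= b i) ->
    lam [set x | forall i, a i <= tnth x i <= b i] = (\prod_(i < d) (b i - a i))%:E.

Definition locally_integrable (lam : {measure set E -> \bar R}) (f : E -> R) :=
  forall r : R, lam.-integrable [set x | vnorm (tnth x) <= r] (EFin \o f).

Definition weak_gradient (lam : {measure set E -> \bar R}) (f : E -> R)
    (G : 'I_d -> E -> R) : Prop :=
  locally_integrable lam f /\ (forall i, locally_integrable lam (G i)) /\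
  forall phi, test_fun phi -> forall i,
    (\int[lam]_x (f x * pd i phi x)%:E = - \int[lam]_x (G i x * phi x)%:E)%E.

(* u solves L u = g - \int g dmu weakly, where L = Delta - grad V . grad is
   symmetric in L^2(mu):  - \int grad u . grad phi dmu = \int (g - m) phi dmu *)
Definition weak_solution (lam mu : {measure set E -> \bar R})
    (u g : E -> R) : Prop :=
  exists Gu, weak_gradient lam u Gu /\
  forall phi, test_fun phi ->
    (- (\int[mu]_x ((\sum_(i < d) Gu i x * pd i phi x)%:E)) =
      \int[mu]_x (((g x - fine (\int[mu]_y (g y)%:E)) * phi x)%:E))%E.

(* C is an admissible (finite) value of the constant C_{Lip,Lip}:
   ||grad u||_oo <= C ||grad g||_oo, with ||grad .||_oo the Lipschitz constant *)
Definition CLipLip_const (lam mu : {measure set E -> \bar R}) (C : R) : Prop :=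
  forall (L : R) (g : E -> R), 0 <= L -> lipschitz_with L g ->
    mu.-integrable setT (EFin \o g) ->
    exists u : E -> R, lipschitz_with (C * L) u /\ weak_solution lam mu u g.

Definition W1 (alpha beta : {measure set E -> \bar R}) : \bar R :=
  ereal_sup [set (\int[alpha]_x (h x)%:E - \int[beta]_x (h x)%:E)%E |
    h in [set h : E -> R | lipschitz_with 1 h /\
      alpha.-integrable setT (EFin \o h) /\ beta.-integrable setT (EFin \o h)]].

End Defs.

(* Main.v *)
(* Let [h] be 1-Lipschitz, [u] a [C]-Lipschitz weak solution of
   [L u = h - \int h dmu] with weak gradient [Gu], and [q = (h - \int h dmu) e^-V].
   Formally,
     [\int h dmu - \int h f dmu = - \int f q = \int Gu . grad f dmu
        <= C \int |grad f| dmu].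
   Neither [f] nor [Gu] is a test function, so the integration by parts goes
   through [\int\int chi(x) f(x) e^-V(y) Gu(y) . (grad K_e)(x - y) dy dx], where
   [chi] is a smooth cutoff and [K_e] a mollifying kernel: for fixed [x] the
   kernel is a test function in the equation of [u], for fixed [y] the product
   [chi K_e] is a test function for the weak gradient of [f], and the two
   evaluations agree by Fubini. The field [e^-V Gu] is only seen through its
   mollification, whose norm is at most [C] times the mollification of [e^-V];
   this follows from the Lipschitz bound on [u] by moving difference quotients,
   without Rademacher's theorem. Finally [e -> 0] and [chi -> 1].
   All test functions are tensor products of one-dimensional smooth functions. *)
Require Import Defs.
From HB Require Import structures.
From mathcomp Require Import all_boot all_order all_algebra.
From mathcomp Require Import all_classical all_reals all_analysis.
From mathcomp Require Import measurable_realfun ring lra.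
Set Implicit Arguments.
Unset Strict Implicit.
Unset Printing Implicit Defensive.
Import Order.TTheory GRing.Theory Num.Theory.
Import numFieldNormedType.Exports.
Local Open Scope classical_set_scope.
Local Open Scope ring_scope.

(** * One-dimensional smooth functions *)

Section bump.
Variable R : realType.
Implicit Types (f g : R -> R) (p : {poly R}) (x : R).

(** The weak gradient [Gu] is only seen under integrals, so a pointwise bound of its norm by [C] is
    never stated. It is replaced by an inequality for each constant direction [v]. The double
    integral makes this sufficient: with the kernel centred at [x] and the integration running over
    [y], the gradient of the cut-off [f] at [x] is a constant vector, and taking it as [v] turns the
    directional inequality into a bound by [C] times its norm. In the limit of small kernels only
    [e^-V] and [(h - \int h dmu) e^-V] are mollified. Both are continuous, so pointwise convergence
    and a local bound suffice, while [f] and its gradient enter merely as integrable factors. Tensor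
    products are closed under partial derivatives, translations and multiplication, so smoothness,
    product rule and chain rule reduce to one variable. Kernels and cutoffs are the same function at
    small and at large scales. It is not normalised: the mass of the kernel is divided out, and the
    cutoffs tend to a positive constant that cancels at the end. *)

Fixpoint times_derivable n f : Prop :=
  if n is m.+1 then (forall x, derivable f x 1) /\ times_derivable m (derive1 f)
  else True.

Definition smooth1 f := forall n, times_derivable n f.

Lemma smooth1_derivable f x : smooth1 f -> derivable f x 1.
Proof. by move=> /(_ 1%N)[]. Qed.

Lemma smooth1_is_derive f x : smooth1 f -> is_derive x 1 f (derive1 f x).
Proof.
by move=> sf; rewrite derive1E; apply: derivableP; exact: smooth1_derivable.
Qed.

Lemma smooth1_derive f : smooth1 f -> smooth1 (derive1 f).
Proof. by move=> sf n; have [] := sf n.+1. Qed.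

Lemma smooth1_continuous f : smooth1 f -> continuous f.
Proof.
by move=> sf x; apply/differentiable_continuous/derivable1_diffP/smooth1_derivable.
Qed.

Lemma times_derivableW n f : times_derivable n.+1 f -> times_derivable n f.
Proof. by elim: n f => // n IH f [df /IH]. Qed.

Lemma is_derive1E f g : (forall x, is_derive x 1 f (g x)) -> derive1 f = g.
Proof.
by move=> fg; apply/funext => x; rewrite derive1E; exact: (@derive_val _ _ _ _ _ _ _ (fg x)).
Qed.

Lemma times_derivableS n f g : (forall x, is_derive x 1 f (g x)) ->
  times_derivable n g -> times_derivable n.+1 f.
Proof.
move=> fg ng; split; last by rewrite (is_derive1E fg).
by move=> x; have [] := fg x.
Qed.

Lemma times_derivableD n f g : times_derivable n f -> times_derivable n g ->
  times_derivable n (f \+ g).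
Proof.
elim: n f g => // n IH f g [df nf] [dg ng].
apply: (@times_derivableS _ _ (derive1 f \+ derive1 g)); last exact: IH.
by move=> x /=; rewrite !derive1E; apply: is_deriveD; apply: derivableP.
Qed.

Lemma times_derivableM n f g : times_derivable n f -> times_derivable n g ->
  times_derivable n (f \* g).
Proof.
elim: n f g => // n IH f g nf ng.
apply: (@times_derivableS _ _ ((f \* derive1 g) \+ (g \* derive1 f))).
  move=> x /=; rewrite !derive1E.
  by apply: is_deriveM; apply: derivableP; [apply nf.1|apply ng.1].
by apply: times_derivableD; apply: IH; do ?[exact: times_derivableW]; [case: ng|case: nf].
Qed.

Lemma smooth1M f g : smooth1 f -> smooth1 g -> smooth1 (f \* g).
Proof. by move=> sf sg n; exact: times_derivableM. Qed.

Lemma is_derive_affine f (df a b x : R) : is_derive (a * x + b) 1 f df ->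
  is_derive x 1 (fun t => f (a * t + b)) (a * df).
Proof.
move=> fd.
have ab : is_derive x 1 (fun t : R => a * t + b) a.
  have -> : (fun t : R => a * t + b) = (a \*: id) + cst b by apply/funext.
  by apply: is_derive_eq; rewrite addr0 [a *: _]mulr1.
by have := @is_derive1_comp _ f (fun t => a * t + b) x _ _ fd ab; rewrite mulrC.
Qed.

Lemma times_derivable_cst n (c : R) : times_derivable n (cst c).
Proof.
elim: n c => // n IH c.
by apply: (@times_derivableS _ _ (cst 0)) => // x; exact: is_derive_cst.
Qed.

Lemma times_derivable_affine n f a b : times_derivable n f ->
  times_derivable n (fun t => f (a * t + b)).
Proof.
elim: n f => // n IH f [df nf].
apply: (@times_derivableS _ _ (cst a \* (fun t => derive1 f (a * t + b)))).
  by move=> x /=; apply: is_derive_affine; rewrite derive1E; apply: derivableP.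
by apply: times_derivableM; [exact: times_derivable_cst|exact: IH].
Qed.

Lemma smooth1_affine f a b : smooth1 f -> smooth1 (fun t => f (a * t + b)).
Proof. by move=> sf n; exact: times_derivable_affine. Qed.

(* The family [flat p] is closed under differentiation, also at [0], hence
   consists of smooth functions. *)
Definition flat p (x : R) : R := if 0 < x then p.[x^-1] * expR (- x^-1) else 0.

Lemma horner_le_pow p (y : R) : 1 <= y ->
  `|p.[y]| <= (\sum_(i < size p) `|p`_i|) * y ^+ size p.
Proof.
move=> y1; rewrite horner_coef (le_trans (ler_norm_sum _ _ _))// mulr_suml.
apply: ler_sum => i _; rewrite normrM ler_wpM2l// normrX ger0_norm ?(le_trans _ y1)//.
by apply: ler_weXn2l => //; exact: ltnW.
Qed.

(** A quadratic bound forces the difference quotient at 0 to vanish. With [y = 1/x >= 1] and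
    [n = size p], the polynomial is at most [S * y^n], while [exp y >= y^(n+2) / (n+2)!]; the two
    spare powers of [y] leave [x^2], and the factorial goes into [M]. *)
Lemma flat_le_sqr p : exists2 M, 0 <= M &
  forall x, `|x| <= 1 -> `|flat p x| <= M * x ^+ 2.
Proof.
pose n := size p; pose S := \sum_(i < n) `|p`_i|.
have S0 : 0 <= S by exact: sumr_ge0.
exists (S * n.+2`!%:R); first by rewrite mulr_ge0.
move=> x x1; rewrite /flat; case: ltP => x0; last first.
  rewrite normr0; apply: mulr_ge0; last exact: sqr_ge0.
  by apply: mulr_ge0; rewrite ?ler0n.
have {}x1 : x <= 1 by rewrite -[x]gtr0_norm.
have y1 : 1 <= x^-1 by rewrite invf_ge1.
set y := x^-1 in y1 *.
rewrite normrM [`|expR _|]ger0_norm ?expR_ge0//.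
have y0 : 0 < y by rewrite (lt_le_trans _ y1).
have eyn : expR (- y) <= n.+2`!%:R / y ^+ n.+2.
  rewrite expRN -[_ / _]invrK lef_pV2 ?posrE ?expR_gt0 ?invr_gt0 ?divr_gt0
    ?exprn_gt0 ?ltr0n ?fact_gt0//.
  by rewrite invfM invrK mulrC (le_trans _ (expR_ge1Dxn n.+1 (ltW y0)))// lerDr.
apply: (le_trans (ler_pM _ _ (horner_le_pow p y1) eyn)) => //.
rewrite -/n -/S -mulrA -mulrA ler_wpM2l//.
have xE : x = y^-1 by rewrite invrK.
rewrite xE -addn2 exprD.
have yn : y ^+ n != 0 by rewrite expf_neq0// gt_eqF.
have y2 : y != 0 by rewrite gt_eqF.
rewrite le_eqVlt; apply/orP; left; apply/eqP.
by field; rewrite y2 yn.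
Qed.

(** For [x > 0] and [y = 1/x], the derivative of [p(y) exp(-y)] in [x] is
    [y^2 (p(y) - p'(y)) exp(-y)], since [y' = - y^2]. For [x < 0] the function is locally zero, and
    at 0 the quadratic bound applies. *)
Lemma is_derive_flat p x : is_derive x 1 (flat p) (flat ('X^2 * (p - p^`())) x).
Proof.
have [x0|x0|->] := ltgtP x 0.
- rewrite [X in is_derive _ _ _ X]/flat ltNge ltW//=.
  apply: (@near_eq_is_derive _ _ _ (cst 0)).
  near=> t; rewrite /flat ltNge ltW//=.
  by near: t; exact: lt_nbhsl.
- rewrite [X in is_derive _ _ _ X]/flat x0.
  pose g := ((fun t => horner p (t^-1)) * (fun t : R => expR (- t^-1))).
  apply: (@near_eq_is_derive _ _ _ g).
    near=> t; rewrite /flat ifT//.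
    by near: t; exact: lt_nbhsr.
  have xV : is_derive x 1 (fun t : R => t^-1) (- x ^- 2).
    have -> : (- x ^- 2) = - x ^- 2 *: (1 : R) by rewrite [_ *: _]mulr1.
    by apply: is_deriveV; rewrite gt_eqF.
  have d1 : is_derive x 1 (fun t => horner p (t^-1)) (p^`().[x^-1] * - x ^- 2).
    have := @is_derive1_comp _ (horner p) (fun t => t^-1) x _ _ (is_derive_poly p _) xV.
    by [].
  have d2 : is_derive x 1 (fun t => expR (- t^-1)) (expR (- x^-1) * x ^- 2).
    have nV : is_derive x 1 (fun t : R => - t^-1) (x ^- 2).
      by have := is_deriveN xV; rewrite opprK.
    exact: (@is_derive1_comp _ expR (fun t => - t^-1) x _ _ (is_derive_expR _) nV).
  have := is_deriveM d1 d2; rewrite -/g => /is_derive_eq; apply.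
  rewrite !hornerE /= -!exprVn [_ *: _]mulrC /GRing.scale/=.
  ring.
- rewrite [X in is_derive _ _ _ X]/flat ltxx.
  have [M M0 HM] := flat_le_sqr p.
  have f0 : flat p 0 = 0 by rewrite /flat ltxx.
  suff H : h^-1 *: (flat p (h *: 1 + 0) - flat p 0) @[h --> 0^'] --> (0 : R).
    apply: DeriveDef; first by apply/cvg_ex; exists 0.
    exact/cvg_lim.
  rewrite f0; apply/cvgr0Pnorm_le => e e0.
  near=> h.
  have h0 : h != 0 by near: h; exact: nbhs_dnbhs_neq.
  rewrite subr0 addr0 [_ *: 1]mulr1 [_ *: _]/(_ * _) normrM normfV.
  rewrite ler_pdivrMl ?normr_gt0//.
  have h1 : `|h| <= 1.
    by near: h; exact: dnbhs0_le.
  apply: (le_trans (HM _ h1)).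
  rewrite -[h ^+ 2]ger0_norm ?sqr_ge0// normrX expr2 mulrCA ler_wpM2l//.
  have : `|h| <= e / (M + 1).
    by near: h; apply: dnbhs0_le; rewrite divr_gt0// ltr_wpDl.
  rewrite ler_pdivlMr ?ltr_wpDl// => /(le_trans _); apply.
  by rewrite mulrDr mulr1 mulrC lerDl.
Unshelve. all: by end_near. Qed.

Lemma smooth1_flat p : smooth1 (flat p).
Proof.
move=> n; elim: n p => // n IH p.
by apply: times_derivableS (IH _) => x; exact: is_derive_flat.
Qed.

Lemma flat1_le1 x : flat 1 x <= 1.
Proof.
rewrite /flat; case: ifPn => // x0; rewrite hornerC mul1r expR_le1 oppr_le0.
by rewrite invr_ge0 ltW.
Qed.

Lemma flat1_ge0 x : 0 <= flat 1 x.
Proof. by rewrite /flat; case: ifPn => // x0; rewrite hornerC mul1r expR_ge0. Qed.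

Lemma flat1_ge_half x : 1 / 2 <= x -> expR (- 2) <= flat 1 x.
Proof.
move=> x2; have x0 : 0 < x by lra.
rewrite /flat x0 hornerC mul1r ler_expR lerN2 invf_ple ?posrE//; lra.
Qed.

(** The reflected product makes the bump even, which later gives the symmetry of the kernel and the
    sign rule for its derivatives. *)
Definition bump (x : R) : R := flat 1 (1 + x) * flat 1 (1 - x).

Lemma smooth1_bump : smooth1 bump.
Proof.
have -> : bump = (fun t => flat 1 (1 * t + 1)) \* (fun t => flat 1 (-1 * t + 1)).
  by apply/funext => x /=; rewrite /bump mul1r mulN1r addrC [1 - x]addrC.
by apply: smooth1M; apply: smooth1_affine; exact: smooth1_flat.
Qed.

Lemma bumpN x : bump (- x) = bump x.
Proof. by rewrite /bump opprK mulrC. Qed.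

Lemma bump_ge0 x : 0 <= bump x.
Proof. by rewrite mulr_ge0 ?flat1_ge0. Qed.

Lemma bump_le1 x : bump x <= 1.
Proof. by rewrite mulr_ile1 ?flat1_ge0 ?flat1_le1. Qed.

Lemma bump_eq0 x : 1 <= `|x| -> bump x = 0.
Proof.
rewrite /bump /flat ler_normr => /orP[] x1.
  by rewrite [X in _ * X]ifF ?mulr0//; apply/negbTE; rewrite -leNgt; lra.
by rewrite ifF ?mul0r//; apply/negbTE; rewrite -leNgt; lra.
Qed.

Lemma bump_ge_half x : `|x| <= 1 / 2 -> expR (- 2) * expR (- 2) <= bump x.
Proof.
rewrite ler_norml => /andP[x1 x2].
by apply: ler_pM; rewrite ?expR_ge0//; apply: flat1_ge_half; lra.
Qed.

End bump.

(** * Functions on R^d *)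

Section euclid.
Variables (R : realType) (d : nat).
Local Notation E := (d.-tuple R).
Implicit Types (v : 'I_d -> R) (x y : E) (phi psi : E -> R).

Lemma vnorm_ge0 v : 0 <= vnorm v.
Proof. exact: sqrtr_ge0. Qed.

Lemma ler_vnorm v i : `|v i| <= vnorm v.
Proof.
rewrite /vnorm -sqrtr_sqr ler_sqrt; last by apply: sumr_ge0 => j _; exact: sqr_ge0.
by rewrite (bigD1 i)//= lerDl sumr_ge0// => j _; exact: sqr_ge0.
Qed.

Lemma vnorm_le_sum v : vnorm v <= \sum_(i < d) `|v i|.
Proof.
have S0 : 0 <= \sum_(i < d) `|v i| by exact: sumr_ge0.
rewrite /vnorm -[leRHS]ger0_norm// -sqrtr_sqr ler_sqrt ?sqr_ge0//.
rewrite expr2 mulr_suml; apply: ler_sum => i _.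
rewrite -[v i ^+ 2]ger0_norm ?sqr_ge0// normrX expr2 ler_wpM2l//.
by rewrite (bigD1 i)//= lerDl sumr_ge0.
Qed.

Lemma vnormZ (t : R) v : vnorm (fun i => t * v i) = `|t| * vnorm v.
Proof.
rewrite /vnorm -sqrtr_sqr -sqrtrM ?sqr_ge0// mulr_sumr.
by under eq_bigr do rewrite exprMn.
Qed.

Lemma ler_edist x y i : `|tnth x i - tnth y i| <= Defs.edist x y.
Proof. exact: (ler_vnorm (fun i => tnth x i - tnth y i)). Qed.

(** The euclidean norm is at most the sum of the coordinates. Dividing by [d.+1] instead of [d]
    keeps the inequality strict and covers [d = 0]. *)
Lemma edist_lt x y (e : R) : 0 < e ->
  (forall i, `|tnth x i - tnth y i| < e / d.+1%:R) -> Defs.edist x y < e.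
Proof.
move=> e0 xy; apply: (le_lt_trans (vnorm_le_sum _)).
apply: (@le_lt_trans _ _ (\sum_(i < d) e / d.+1%:R)).
  by apply: ler_sum => i _; exact/ltW.
rewrite sumr_const card_ord -[X in X < _]mulr_natr mulrAC.
by rewrite ltr_pdivrMr ?ltr0n// ltr_pM2l// ltr_nat.
Qed.

(* Tuples carry no topology in the library; this is the filter of [edist]-balls. *)
Definition enbhs x : set_system E :=
  [set A | exists2 e : R, 0 < e & forall y, Defs.edist y x < e -> A y].

Lemma edistxx x : Defs.edist x x = 0.
Proof.
rewrite /Defs.edist /vnorm big1 ?sqrtr0// => i _.
by rewrite subrr expr0n.
Qed.

Global Instance enbhs_filter x : ProperFilter (enbhs x).
Proof.
split.
  by move=> [e e0 /(_ x)]; rewrite edistxx; exact.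
split.
- by exists 1.
- move=> P Q [e e0 eP] [r r0 rQ]; exists (Num.min e r); first by rewrite lt_min e0.
  by move=> y; rewrite lt_min => /andP[/eP Py /rQ Qy].
- by move=> P Q PQ [e e0 eP]; exists e => // y /eP/PQ.
Qed.

Lemma econtinuousP phi :
  econtinuous phi <-> forall x, phi y @[y --> enbhs x] --> phi x.
Proof.
split=> H x.
  apply/cvgrPdist_lt => e e0; have [r r0 xr] := H x e e0.
  by exists r => // y /xr; rewrite distrC.
move=> e e0; have /cvgrPdist_lt/(_ e e0)[r r0 xr] := H x.
by exists r => // y /xr; rewrite distrC.
Qed.

Lemma econtinuous_cst (c : R) : econtinuous (cst c : E -> R).
Proof. by apply/econtinuousP => x; exact: cvg_cst. Qed.

Lemma econtinuousM phi psi : econtinuous phi -> econtinuous psi ->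
  econtinuous (phi \* psi).
Proof.
by move=> /econtinuousP cf /econtinuousP cg; apply/econtinuousP => x; exact: cvgM.
Qed.

Lemma econtinuousB phi psi : econtinuous phi -> econtinuous psi ->
  econtinuous (phi \- psi).
Proof.
by move=> /econtinuousP cf /econtinuousP cg; apply/econtinuousP => x; exact: cvgB.
Qed.

Lemma econtinuous_comp phi (g : R -> R) : econtinuous phi -> continuous g ->
  econtinuous (g \o phi).
Proof.
move=> /econtinuousP cf cg; apply/econtinuousP => x.
exact: (continuous_cvg _ (cg _) (cf x)).
Qed.

Lemma econtinuous_tnth i : econtinuous (fun x => tnth x i).
Proof.
move=> x e e0; exists e => // y; apply: le_lt_trans; exact: ler_edist.
Qed.

Lemma lipschitz_econtinuous (L : R) phi : lipschitz_with L phi -> econtinuous phi.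
Proof.
move=> Lphi x e e0; have L1 : 0 < `|L| + 1 by rewrite ltr_wpDl.
exists (e / (`|L| + 1)); first by rewrite divr_gt0.
move=> y; rewrite ltr_pdivlMr// mulrDr mulr1 => yx.
apply: (le_lt_trans (Lphi y x)); apply: le_lt_trans yx.
have e0' : 0 <= Defs.edist y x by exact: vnorm_ge0.
by rewrite mulrC (@le_trans _ _ (Defs.edist y x * `|L|)) ?lerDl// ler_wpM2l// ler_norm.
Qed.

Definition box (r : R) : set E := [set x | forall i, `|tnth x i| <= r].

End euclid.

(** * Continuous functions: local boundedness and measurability *)

Section continuous_functions.
Variables (R : realType) (d : nat).
Local Notation E := (d.-tuple R).
Implicit Types (phi : E -> R).

(** Compactness is borrowed from row vectors, where the box is a product of segments; in dimension 0
    there is a single point. *)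
Lemma econtinuous_bounded phi (r : R) : econtinuous phi ->
  exists2 M, 0 <= M & forall x : E, box r x -> `|phi x| <= M.
Proof.
rewrite /box; case: d phi => [|n] phi cphi.
  by exists `|phi [tuple]| => // x _; rewrite (tuple0 x).
pose f (u : 'rV[R]_n.+1) := phi [tuple u ord0 i | i < n.+1].
have cf : continuous f.
  move=> u; apply: (proj2 (@cvgrPdist_lt _ _ _ (nbhs u) _ f (f u))) => e e0.
  have [del del0 H] := cphi [tuple u ord0 i | i < n.+1] e e0.
  have d0 : 0 < del / n.+2%:R by rewrite divr_gt0// ltr0n.
  near=> u'; rewrite distrC; apply: H.
  apply: edist_lt => // i; rewrite !tnth_mktuple.
  have : ball u (del / n.+2%:R) u' by near: u'; exact: nbhsx_ballx.
  by rewrite /ball/= => -[_ /(_ ord0 i)]; rewrite distrC.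
pose K := [set u : 'rV[R]_n.+1 | forall i, `[- r, r]%classic (u ord0 i)].
have cK : compact K.
  by apply: (@rV_compact _ _ (fun=> `[- r, r]%classic)) => i; exact: segment_compact.
have /compact_bounded[M [_ HM]] : compact (f @` K).
  by apply: continuous_compact => //; exact: continuous_subspaceT.
exists (`|M| + 1); first by rewrite addr_ge0.
move=> x xr; apply: (HM (`|M| + 1)); first by rewrite (le_lt_trans (ler_norm _))// ltrDl.
exists (\row_i tnth x i).
  by move=> i /=; rewrite mxE in_itv/= -ler_norml.
rewrite /f; congr (phi _); apply: eq_from_tnth => i.
by rewrite tnth_mktuple mxE.
Unshelve. all: by end_near. Qed.

(** Rounding every coordinate down to the grid of step [1/(n+1)] gives a function that is constant
    on countably many measurable cells, hence measurable after composition with [phi]. By continuity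
    these compositions converge pointwise to [phi]. *)
Lemma econtinuous_measurable phi : econtinuous phi -> measurable_fun setT phi.
Proof.
move=> /econtinuousP cphi.
pose cell n (k : d.-tuple int) : set E :=
  [set x | forall i, Num.floor (tnth x i * n.+1%:R) = tnth k i].
pose pt n (k : d.-tuple int) : E := [tuple (tnth k i)%:~R / n.+1%:R | i < d].
pose rd n (x : E) : E := pt n [tuple Num.floor (tnth x i * n.+1%:R) | i < d].
have mcell n k : measurable (cell n k).
  have -> : cell n k = \bigcap_(i in [set: 'I_d])
      ((fun x => tnth x i) @^-1` [set t | (tnth k i)%:~R <= t * n.+1%:R < (tnth k i + 1)%:~R]).
    apply/seteqP; split=> [x xk i _ /=|x xk i /=].
      by rewrite -(xk i) floor_le// floorD1_gt.
    exact/floor_def/(xk i).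
  apply: fin_bigcap_measurable => // i _.
  rewrite -[X in measurable X]setTI; apply: measurable_tnth => //.
  rewrite (_ : [set t | _] = `[(tnth k i)%:~R / n.+1%:R, (tnth k i + 1)%:~R / n.+1%:R[%classic)//.
  apply/seteqP; split=> t /=; rewrite in_itv/= ler_pdivrMr ?ltr0n// ltr_pdivlMr ?ltr0n//.
apply: (measurable_fun_cvg (h := fun n x => phi (rd n x))).
  move=> n _ Y mY; rewrite setTI.
  have -> : (fun x => phi (rd n x)) @^-1` Y =
      \bigcup_(k in [set: d.-tuple int]) (if phi (pt n k) \in Y then cell n k else set0).
    apply/seteqP; split=> [x /= Yx|x [k _]].
      exists [tuple Num.floor (tnth x i * n.+1%:R) | i < d] => //.
      by rewrite ifT ?inE// => i; rewrite tnth_mktuple.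
    case: ifPn => // /set_mem Yk xk.
    rewrite /= /rd (_ : [tuple _ | i < d] = k)//.
    by apply: eq_from_tnth => i; rewrite tnth_mktuple.
  apply: countable_bigcupT_measurable => // k; by case: ifP.
move=> x _; apply: (cvg_trans _ (cphi x)).
move=> A [e e0 HA].
have : (fun n => n.+1%:R^-1 : R) @ \oo --> (0 : R).
  exact: cvg_harmonic.
move=> /cvgr0Pnorm_lt /(_ (e / d.+1%:R)) H.
have [|N _ HN] := H _; first by rewrite divr_gt0// ltr0n.
exists N => // n Nn; apply: HA; apply: edist_lt => // i.
apply: le_lt_trans (HN _ Nn).
rewrite /rd /pt !tnth_mktuple.
have n0 : 0 < n.+1%:R :> R by rewrite ltr0n.
rewrite -[tnth x i in X in _ - X](mulfK (lt0r_neq0 n0)) -mulrBl normrM ler_piMl//.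
rewrite distrC ger0_norm ?subr_ge0 ?floor_le//.
by rewrite lerBlDl -[X in _ + X]/(1%:~R) -intrD ltW// floorD1_gt.
Qed.

End continuous_functions.

(** * Tensor products of smooth functions of one variable *)

Section tensor.
Variables (R : realType) (d : nat).
Local Notation E := (d.-tuple R).
Implicit Types (b : 'I_d -> R -> R) (x y : E) (v : 'I_d -> R).

Definition tens b x : R := \prod_(j < d) b j (tnth x j).

Definition dtens b i : 'I_d -> R -> R :=
  fun j => if j == i then derive1 (b i) else b j.

Definition tsmooth b := forall j, smooth1 (b j).

(** The strict inequality describes an open set, so the derivatives of the factors vanish on it as
    well and [r] is preserved by [dtens]. *)
Definition tsupp b (r : R) := forall j t, r < `|t| -> b j t = 0.

Definition line x v (t : R) : E := [tuple tnth x j + t * v j | j < d].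

Lemma tens_dtens b i x : tens (dtens b i) x =
  derive1 (b i) (tnth x i) * \prod_(j < d | j != i) b j (tnth x j).
Proof.
rewrite /tens (bigD1 i)//= /dtens eqxx; congr (_ * _).
by apply: eq_bigr => j /negbTE ->.
Qed.

Lemma is_derive_prod (I : eqType) (s : seq I) (F : I -> R -> R) (dF : I -> R) (t : R) :
  uniq s -> (forall i, is_derive t 1 (F i) (dF i)) ->
  is_derive t 1 (fun u => \prod_(i <- s) F i u)
    (\sum_(i <- s) dF i * \prod_(j <- s | j != i) F j t).
Proof.
move=> + Fd; elim: s => [_|a s IH /= /andP[as_ us]].
  rewrite big_nil (_ : (fun _ => _) = cst 1); first exact: is_derive_cst.
  by apply/funext => u; rewrite big_nil.
rewrite (_ : (fun _ => _) = F a * (fun u => \prod_(i <- s) F i u)); last first.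
  by apply/funext => u; rewrite big_cons.
apply: is_derive_eq; first exact: (is_deriveM (Fd a) (IH us)).
rewrite big_cons addrC big_cons eqxx /=; congr (_ + _).
  rewrite [_ *: _]mulrC; congr (_ * _).
  rewrite [LHS]big_seq [RHS]big_seq_cond; apply: eq_bigl => j.
  case js : (j \in s) => //=; apply/esym/eqP => ja.
  by rewrite -ja js in as_.
rewrite [LHS]mulr_sumr [LHS]big_seq [RHS]big_seq; apply: eq_bigr => i is_.
rewrite big_cons ifT; first by rewrite mulrCA.
by apply: contraNneq as_ => ->.
Qed.

(** Restricted to a line, a tensor product is a finite product of functions of one variable, so the
    chain rule in several variables reduces to the product rule. *)
Lemma is_derive_tens_line b x v (t : R) : tsmooth b ->
  is_derive t 1 (fun u => tens b (line x v u))
    (\sum_(i < d) v i * tens (dtens b i) (line x v t)).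
Proof.
move=> sb.
pose F i (u : R) := b i (v i * u + tnth x i).
rewrite (_ : (fun u => _) = (fun u => \prod_(i <- index_enum 'I_d) F i u)); last first.
  apply/funext => u; apply: eq_bigr => i _.
  by rewrite /F tnth_mktuple addrC mulrC.
apply: is_derive_eq.
  apply: (@is_derive_prod _ _ F (fun i => v i * derive1 (b i) (v i * t + tnth x i))).
    exact: index_enum_uniq.
  by move=> i; apply: is_derive_affine; exact: smooth1_is_derive.
apply: eq_bigr => i _; rewrite tens_dtens mulrA; congr (_ * _ * _).
  by rewrite tnth_mktuple addrC mulrC.
by apply: eq_bigr => j _; rewrite /F tnth_mktuple addrC mulrC.
Qed.

Lemma is_derive_tens_shift b x i : tsmooth b ->
  is_derive (0 : R) 1 (fun t => tens b (Defs.shift x i t)) (tens (dtens b i) x).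
Proof.
move=> sb; pose v (j : 'I_d) : R := (j == i)%:R.
have xE : Defs.shift x i = line x v.
  apply/funext => t; apply: eq_from_tnth => j; rewrite !tnth_mktuple /v.
  by case: eqP => _; rewrite ?mulr1 ?mulr0.
rewrite xE; apply: is_derive_eq; first exact: is_derive_tens_line.
rewrite (bigD1 i)//= big1 ?addr0 => [|j /negbTE ji]; last by rewrite /v ji mul0r.
rewrite /v eqxx mul1r; congr tens; apply: eq_from_tnth => j.
by rewrite tnth_mktuple mul0r addr0.
Qed.

Lemma pd_tens b i : tsmooth b -> pd i (tens b) = tens (dtens b i).
Proof.
move=> sb; apply/funext => x; rewrite /pd derive1E.
exact: (@derive_val _ _ _ _ _ _ _ (is_derive_tens_shift x i sb)).
Qed.

Lemma tsmooth_dtens b i : tsmooth b -> tsmooth (dtens b i).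
Proof. by move=> sb j; rewrite /dtens; case: eqP => // _; exact: smooth1_derive. Qed.

Lemma tsupp_dtens b i r : tsupp b r -> tsupp (dtens b i) r.
Proof.
move=> sb j t rt; rewrite /dtens; case: eqP => _; last exact: sb.
rewrite derive1E; apply: (@derive_val _ _ _ _ _ _ _ _).
apply: (@near_eq_is_derive _ _ _ (cst 0)).
near=> u; apply/esym/sb.
near: u; have : `|u| @[u --> t] --> `|t| by exact: norm_continuous.
by move=> /(cvgr_gt _)/(_ _ rt).
Unshelve. all: by end_near. Qed.

Lemma econtinuous_prod (s : seq 'I_d) b : (forall j, continuous (b j)) ->
  econtinuous (fun x => \prod_(j <- s) b j (tnth x j)).
Proof.
move=> cb; elim: s => [|j s IH].
  rewrite (_ : (fun x : E => _) = cst 1); first exact: econtinuous_cst.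
  by apply/funext => x; rewrite big_nil.
rewrite (_ : (fun x : E => _) = ((b j) \o (fun x : E => tnth x j)) \*
    (fun x => \prod_(j <- s) b j (tnth x j))); last first.
  by apply/funext => x; rewrite big_cons.
apply: econtinuousM => //; apply: econtinuous_comp => //.
exact: econtinuous_tnth.
Qed.

Lemma econtinuous_tens b : tsmooth b -> econtinuous (tens b).
Proof. by move=> sb; apply: econtinuous_prod => j; exact: smooth1_continuous. Qed.

Lemma iter_pd_tens (s : seq 'I_d) b : tsmooth b ->
  exists2 b', tsmooth b' & iter_pd s (tens b) = tens b'.
Proof.
move=> sb; elim: s => [|i s [b' sb' E']]; first by exists b.
exists (dtens b' i); first exact: tsmooth_dtens.
by rewrite /= E' pd_tens.
Qed.

Lemma smooth_tens b : tsmooth b -> smooth (tens b).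
Proof.
move=> sb k s _; have [b' sb' ->] := iter_pd_tens s sb; split.
  exact: econtinuous_tens.
move=> _ i x.
have := is_derive_tens_shift x i sb'.
by case.
Qed.

Lemma tens_eq0 b r x : tsupp b r -> ~ box r x -> tens b x = 0.
Proof.
move=> sb /existsNP[i /negP]; rewrite -ltNge => xi.
by rewrite /tens (bigD1 i)//= sb ?mul0r.
Qed.

Lemma box_vnorm r x : box r x -> vnorm (tnth x) <= d%:R * r.
Proof.
move=> xr; apply: (le_trans (vnorm_le_sum _)).
rewrite mulr_natl -[X in _ *+ X]card_ord -sumr_const; exact: ler_sum.
Qed.

Lemma test_fun_tens b r : tsmooth b -> tsupp b r -> test_fun (tens b).
Proof.
move=> sb rb; split; first exact: smooth_tens.
exists (d%:R * r) => x; rewrite ltNge => /negP xr.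
by apply: (tens_eq0 rb) => /box_vnorm.
Qed.

Lemma tens_bounded b r : tsmooth b -> tsupp b r ->
  exists2 M, 0 <= M & forall x, `|tens b x| <= M.
Proof.
move=> sb rb; have [M M0 HM] := econtinuous_bounded r (econtinuous_tens sb).
exists M => // x; have [/HM//|xr] := pselect (box r x).
by rewrite (tens_eq0 rb xr) normr0.
Qed.

Lemma tens_ge0 b x : (forall j t, 0 <= b j t) -> 0 <= tens b x.
Proof. by move=> b0; exact: prodr_ge0. Qed.

Lemma tensM b b' x : tens (fun j => b j \* b' j) x = tens b x * tens b' x.
Proof. by rewrite /tens -big_split. Qed.

Lemma tsmoothM b b' : tsmooth b -> tsmooth b' -> tsmooth (fun j => b j \* b' j).
Proof. by move=> sb sb' j; exact: smooth1M. Qed.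

Lemma tsuppM b b' r : tsupp b r -> tsupp (fun j => b j \* b' j) r.
Proof. by move=> sb j t rt /=; rewrite sb ?mul0r. Qed.

Lemma pd_tensM b b' i x : tsmooth b -> tsmooth b' ->
  pd i (tens (fun j => b j \* b' j)) x =
  tens (dtens b i) x * tens b' x + tens b x * tens (dtens b' i) x.
Proof.
move=> sb sb'; rewrite pd_tens; last exact: tsmoothM.
rewrite [LHS]tens_dtens !tens_dtens /tens.
have -> : derive1 (b i \* b' i) (tnth x i) =
    derive1 (b i) (tnth x i) * b' i (tnth x i) + b i (tnth x i) * derive1 (b' i) (tnth x i).
  rewrite [LHS]derive1E.
  have := is_deriveM (smooth1_is_derive (tnth x i) (sb i)) (smooth1_is_derive (tnth x i) (sb' i)).
  move=> /(@derive_val _ _ _ _ _ _ _) ->.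
  by rewrite addrC [_ *: _]mulrC.
rewrite [X in _ = _ * X + _](bigD1 i)//= [X in _ = _ + X * _](bigD1 i)//= big_split/=.
ring.
Qed.

End tensor.

(** * Integration *)

Section real_integrals.
Context {disp : measure_display} {T : measurableType disp} {R : realType}.
Variable mu : {measure set T -> \bar R}.
Implicit Types (F G : T -> R).

Lemma measurable_integrable F : mu.-integrable setT (EFin \o F) ->
  measurable_fun setT F.
Proof. by move=> /(measurable_int mu)/measurable_EFinP. Qed.

Lemma integrable_le F G : measurable_fun setT F ->
  (forall x, `|F x| <= G x) -> mu.-integrable setT (EFin \o G) ->
  mu.-integrable setT (EFin \o F).
Proof.
move=> mF FG; apply: le_integrable => //; first exact/measurable_EFinP.
by move=> x _ /=; rewrite lee_fin (le_trans (FG x))// ler_norm.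
Qed.

Lemma integrable_scale (c : R) F : mu.-integrable setT (EFin \o F) ->
  mu.-integrable setT (EFin \o (fun x => c * F x)).
Proof.
move=> iF; rewrite (_ : _ \o _ = (fun x => c%:E * (EFin \o F) x)%E).
  exact: integrableZl.
by apply/funext => x /=; rewrite EFinM.
Qed.

Lemma integrable_mul_bounded F G (M : R) : mu.-integrable setT (EFin \o F) ->
  measurable_fun setT G -> (forall x, `|G x| <= M) ->
  mu.-integrable setT (EFin \o (fun x => F x * G x)).
Proof.
move=> iF mG GM.
apply: (@integrable_le _ (fun x => M * `|F x|)).
- by apply: measurable_funM => //; exact: measurable_integrable.
- by move=> x; rewrite normrM mulrC ler_wpM2r.
- by apply: integrable_scale; exact: integrable_norm.
Qed.

Lemma integrable_add F G : mu.-integrable setT (EFin \o F) ->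
  mu.-integrable setT (EFin \o G) ->
  mu.-integrable setT (EFin \o (fun x => F x + G x)).
Proof.
move=> iF iG; rewrite (_ : _ \o _ = (EFin \o F) \+ (EFin \o G))%E//.
exact: integrableD.
Qed.

Lemma integrable_bigsum (I : Type) (s : seq I) (F : I -> T -> R) :
  (forall i, mu.-integrable setT (EFin \o F i)) ->
  mu.-integrable setT (EFin \o (fun x => \sum_(i <- s) F i x)).
Proof.
move=> iF; elim: s => [|i s IH].
  rewrite (_ : _ \o _ = cst 0%E); first exact: integrable0.
  by apply/funext => x /=; rewrite big_nil.
rewrite (_ : _ \o _ = EFin \o (fun x => F i x + \sum_(i <- s) F i x)).
  exact: integrable_add.
by apply/funext => x /=; rewrite big_cons.
Qed.

Lemma Rintegral_bigsum (I : Type) (s : seq I) (F : I -> T -> R) :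
  (forall i, mu.-integrable setT (EFin \o F i)) ->
  \int[mu]_x (\sum_(i <- s) F i x) = \sum_(i <- s) \int[mu]_x F i x.
Proof.
move=> iF; elim: s => [|i s IH].
  rewrite big_nil (_ : (fun x => _) = cst 0) ?Rintegral_cst ?mul0r//.
  by apply/funext => x; rewrite big_nil.
rewrite big_cons -IH -RintegralD//; last exact: integrable_bigsum.
by apply: eq_Rintegral => x _; rewrite big_cons.
Qed.

Lemma EFin_Rintegral F : mu.-integrable setT (EFin \o F) ->
  (\int[mu]_x F x)%:E = (\int[mu]_x (F x)%:E)%E.
Proof. by move=> iF; rewrite fineK//; exact: integrable_fin_num. Qed.

Lemma dominated_Rintegral (F : nat -> T -> R) G H :
  (forall n, measurable_fun setT (F n)) ->
  (forall x, F n x @[n --> \oo] --> G x) ->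
  mu.-integrable setT (EFin \o H) -> (forall n x, `|F n x| <= H x) ->
  mu.-integrable setT (EFin \o G) /\
  \int[mu]_x F n x @[n --> \oo] --> \int[mu]_x G x.
Proof.
move=> mF FG iH FH.
have [] := @dominated_convergence _ _ _ mu setT measurableT
  (fun n x => (F n x)%:E) (EFin \o G) (EFin \o H).
- by move=> n; exact/measurable_EFinP.
- apply/measurable_EFinP.
  by apply: (measurable_fun_cvg (h := F)) => // x _.
- by apply: aeW => x _; apply: cvg_EFin; [exact: nearW|exact: FG].
- exact: iH.
- by apply: aeW => x n _; rewrite /= lee_fin.
move=> iG _ cvgG; split=> //.
apply: fine_cvg; rewrite /= EFin_Rintegral//.
Qed.

End real_integrals.

(** * Change of density *)

Section density.
Context {disp : measure_display} {T : measurableType disp} {R : realType}.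
Variables (lam mu : {measure set T -> \bar R}) (k : T -> R).
Hypothesis k0 : forall x, 0 <= k x.
Hypothesis mk : measurable_fun setT k.
Hypothesis mukE : forall A, measurable A -> (mu A = \int[lam]_(x in A) (k x)%:E)%E.

Import HBNNSimple.

(** The hypothesis on [mu] is the case of indicators; sums over level sets give simple functions,
    and monotone convergence on both sides gives the rest. The section serves twice: for [mu] with
    density [e^-V] and for [nu] with density [f] with respect to [mu]. *)
Lemma ge0_integral_density (F : T -> \bar R) : (forall x, 0 <= F x)%E ->
  measurable_fun setT F ->
  (\int[mu]_x F x = \int[lam]_x (F x * (k x)%:E))%E.
Proof.
move=> F0 mF; pose h := nnsfun_approx measurableT mF.
have Fh x : EFin (h n x) @[n --> \oo] --> F x by exact: cvg_nnsfun_approx.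
transitivity (limn (fun n => \int[mu]_x (h n x)%:E))%E.
  rewrite -monotone_convergence//.
  - by apply: eq_integral => x _; apply/esym/cvg_lim => //; exact: Fh.
  - by move=> n; exact/measurable_EFinP.
  - by move=> n x _; rewrite lee_fin.
  - by move=> x _ a b ab; rewrite lee_fin; exact/lefP/nd_nnsfun_approx.
transitivity (limn (fun n => \int[lam]_x ((h n x)%:E * (k x)%:E)))%E; last first.
  rewrite -monotone_convergence//.
  - apply: eq_integral => x _; apply/cvg_lim => //.
    by apply: cvgeZr => //; exact: Fh.
  - by move=> n; apply: emeasurable_funM; exact/measurable_EFinP.
  - by move=> n x _; rewrite mule_ge0// lee_fin.
  - move=> x _ a b ab; rewrite lee_wpmul2r ?lee_fin//.
    exact/lefP/nd_nnsfun_approx.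
congr (limn _); apply/funext => n; rewrite integralT_nnsfun sintegralE.
have -> : (\int[lam]_x ((h n x)%:E * (k x)%:E) =
  \int[lam]_x (\sum_(y \in range (h n)) (y%:E * ((k x) * \1_(h n @^-1` [set y]) x)%:E)))%E.
  apply: eq_integral => x _; rewrite [in LHS](fimfunE (h n) x) -fsumEFin// ge0_mule_fsuml.
    apply: eq_fsbigr => y _; rewrite -!EFinM; congr EFin; ring.
  by move=> y; exact: nnfun_muleindic_ge0.
rewrite ge0_integral_fsum//; last 2 first.
- move=> y; apply: emeasurable_funM => //; apply/measurable_EFinP.
  by apply: measurable_funM => //; exact: measurable_indic.
- move=> y x _; have [y0|y0] := leP 0 y; first by rewrite mule_ge0// lee_fin ?mulr_ge0.
  by rewrite preimage_nnfun0// indic0 mulr0 mule0.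
apply: eq_fsbigr => y _.
have [y0|y0] := leP 0 y; last first.
  rewrite preimage_nnfun0// measure0 mule0 integral0_eq// => x _.
  by rewrite indic0 mulr0 mule0.
rewrite ge0_integralZl ?lee_fin//; last 2 first.
- apply/measurable_EFinP.
  by apply: measurable_funM => //; exact: measurable_indic.
- by move=> x _; rewrite lee_fin mulr_ge0.
rewrite mukE//; congr (_ * _)%E.
rewrite integral_mkcond; apply: eq_integral => x _.
by rewrite patchE indicE; case: ifP => _; rewrite ?mulr1 ?mulr0.
Qed.

Lemma integrable_density (F : T -> R) : measurable_fun setT F ->
  mu.-integrable setT (EFin \o F) <->
  lam.-integrable setT (EFin \o (fun x => F x * k x)).
Proof.
move=> mF; have mFk : measurable_fun setT (fun x => F x * k x) by exact: measurable_funM.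
have E : (\int[mu]_x `|(EFin \o F) x| =
    \int[lam]_x `|(EFin \o (fun x => F x * k x)%R) x|)%E.
  rewrite ge0_integral_density//.
    by apply: eq_integral => x _; rewrite /= normrM [`|k x|]ger0_norm.
  by apply: measurableT_comp => //; exact/measurable_EFinP.
split=> /integrableP[_ H]; apply/integrableP; split.
- exact/measurable_EFinP.
- by rewrite -E.
- exact/measurable_EFinP.
- by rewrite E.
Qed.

(** Multiplication by the nonnegative [k] commutes with positive and negative parts, so the two
    parts transfer separately. *)
Lemma Rintegral_density (F : T -> R) : measurable_fun setT F ->
  \int[mu]_x F x = \int[lam]_x (F x * k x).
Proof.
move=> mF; rewrite /Rintegral integralE [in RHS]integralE.
have maxM (a b : R) : 0 <= b -> (maxe a%:E 0 * b%:E = maxe (a * b)%:E 0)%E.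
  by move=> b0; rewrite -!EFin_max -EFinM maxr_pMl// mul0r.
rewrite !ge0_integral_density//; last 2 first.
- by apply: measurable_funeneg; exact/measurable_EFinP.
- by apply: measurable_funepos; exact/measurable_EFinP.
congr (fine (_ - _)); apply: eq_integral => x _; rewrite ?funeposE ?funenegE /=.
  exact: maxM.
by rewrite -mulNr -maxM// EFinN.
Qed.

End density.

(** * Fubini's theorem with a bounded kernel *)

Section fubini_kernel.
Context {disp : measure_display} {T : measurableType disp} {R : realType}.

(** By Tonelli, [A(x) B(y) k(x, y)] is integrable on the product, being dominated by
    [M |A(x)| |B(y)|]; the two iterated integrals are its partial integrals with the constant factor
    pulled out. *)
Let fubini_kernel_sigma_finite (m : {sigma_finite_measure set T -> \bar R})
    (A B : T -> R) (k : T * T -> R) (M : R) :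
  m.-integrable setT (EFin \o A) -> m.-integrable setT (EFin \o B) ->
  measurable_fun setT k -> (forall z, `|k z| <= M) ->
  m.-integrable setT (EFin \o (fun x => A x * \int[m]_y (B y * k (x, y)))) /\
  \int[m]_x (A x * \int[m]_y (B y * k (x, y))) =
  \int[m]_y (B y * \int[m]_x (A x * k (x, y))).
Proof.
move=> iA iB mk kM.
have mA := measurable_integrable iA; have mB := measurable_integrable iB.
pose F (z : T * T) := A z.1 * B z.2 * k z.
have mF : measurable_fun setT F.
  apply: measurable_funM => //; apply: measurable_funM.
    exact: (measurableT_comp mA).
  exact: (measurableT_comp mB).
have mk1 x : measurable_fun setT (fun y => k (x, y)).
  exact: measurableT_comp.
have mk2 y : measurable_fun setT (fun x => k (x, y)).
  exact: measurableT_comp.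
have iB1 x : m.-integrable setT (EFin \o (fun y => B y * k (x, y))).
  by apply: integrable_mul_bounded iB (mk1 x) _ => y; exact: kM.
have iA1 y : m.-integrable setT (EFin \o (fun x => A x * k (x, y))).
  by apply: integrable_mul_bounded iA (mk2 y) _ => x; exact: kM.
have iF : (m \x m)%E.-integrable setT (EFin \o F).
  apply/integrable12ltyP; first exact/measurable_EFinP.
  apply: (@le_lt_trans _ _ (\int[m]_x (`|A x| * \int[m]_y (M * `|B y|))%:E)%E).
    apply: ge0_le_integral => //.
    - by move=> ? _; exact: integral_ge0.
    - apply: (measurable_fun_fubini_tonelli_F (fun z => `|(F z)%:E|%E)) => //.
      by apply: measurableT_comp => //; exact/measurable_EFinP.
    - apply/measurable_EFinP; apply: measurable_funM => //.
      exact: measurableT_comp.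
    - move=> x _.
      have iMB : m.-integrable setT (EFin \o (fun y => M * `|B y|)).
        by apply: integrable_scale; exact: integrable_norm.
      rewrite EFinM EFin_Rintegral// -integralZl//.
      apply: ge0_le_integral => //.
      + apply: measurableT_comp => //; apply/measurable_EFinP.
        exact: measurableT_comp mF _.
      + apply/emeasurable_funM => //; exact: measurable_int iMB.
      + move=> y _; rewrite -EFinM lee_fin /F/= !normrM -mulrA ler_wpM2l//.
        by rewrite mulrC ler_wpM2r.
  have : m.-integrable setT (EFin \o (fun x => \int[m]_y (M * `|B y|) * `|A x|)).
    by apply: integrable_scale; exact: integrable_norm.
  move=> /(integrable_fin_num measurableT) /=.
  rewrite (_ : (\int[m]_x _)%E = (\int[m]_x (`|A x| * \int[m]_y (M * `|B y|))%:E)%E).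
    by rewrite fin_numE ltey => /andP[].
  by apply: eq_integral => ? _ /=; rewrite mulrC.
have FE : fubini_F m (EFin \o F) = EFin \o (fun x => A x * \int[m]_y (B y * k (x, y))).
  apply/funext => x; rewrite /fubini_F /= EFinM EFin_Rintegral//.
  rewrite -integralZl//; last exact: (iB1 x).
  by apply: eq_integral => y _; rewrite /F /= -EFinM mulrA.
have GE : fubini_G m (EFin \o F) = EFin \o (fun y => B y * \int[m]_x (A x * k (x, y))).
  apply/funext => y; rewrite /fubini_G /= EFinM EFin_Rintegral//.
  rewrite -integralZl//; last exact: (iA1 y).
  by apply: eq_integral => u _; rewrite /F /= -EFinM; congr EFin; ring.
split; first by rewrite -FE; exact: integrable_fubini_F.
rewrite /Rintegral; congr fine.
transitivity (\int[m]_x fubini_F m (EFin \o F) x)%E; first by rewrite FE.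
transitivity (\int[m]_y fubini_G m (EFin \o F) y)%E; last by rewrite GE.
exact: Fubini.
Qed.

Section sigma_finite_copy.
Variable m : {measure set T -> \bar R}.
Hypothesis sm : sigma_finite setT m.

(* Carries the proof of sigma-finiteness, so that the structure can be inferred. *)
Definition sigma_finite_copy of sigma_finite setT m : set T -> \bar R := m.

HB.instance Definition _ := Measure.on (sigma_finite_copy sm).
HB.instance Definition _ :=
  @Measure_isSigmaFinite.Build _ _ _ (sigma_finite_copy sm) sm.

Lemma fubini_kernel (A B : T -> R) (k : T * T -> R) (M : R) :
  m.-integrable setT (EFin \o A) -> m.-integrable setT (EFin \o B) ->
  measurable_fun setT k -> (forall z, `|k z| <= M) ->
  m.-integrable setT (EFin \o (fun x => A x * \int[m]_y (B y * k (x, y)))) /\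
  \int[m]_x (A x * \int[m]_y (B y * k (x, y))) =
  \int[m]_y (B y * \int[m]_x (A x * k (x, y))).
Proof. exact: (@fubini_kernel_sigma_finite (sigma_finite_copy sm)). Qed.

End sigma_finite_copy.

End fubini_kernel.

(** * Lebesgue measure: generation by rectangles and translation invariance *)

Section lebesgue.
Variables (R : realType) (d : nat).
Local Notation E := (d.-tuple R).
Variable lam : {measure set E -> \bar R}.
Hypothesis Hlam : is_lebesgue lam.
Implicit Types (a b : 'I_d -> R) (x y c : E).

Definition rect a b : set E := [set x | forall i, a i <= tnth x i <= b i].

Lemma rect_bigcap a b : rect a b =
  \bigcap_(i in [set: 'I_d]) ((fun x => tnth x i) @^-1` `[a i, b i]%classic).
Proof.
apply/seteqP; split=> [x xab i _ /=|x xab i].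
  by rewrite in_itv/=; exact: xab.
by have := xab i I; rewrite /= in_itv.
Qed.

Lemma measurable_rect a b : measurable (rect a b).
Proof.
rewrite rect_bigcap; apply: fin_bigcap_measurable => // i _.
by rewrite -[X in measurable X]setTI; exact: measurable_tnth.
Qed.

Lemma boxE (r : R) : box r = rect (fun=> - r) (fun=> r).
Proof. by apply/seteqP; split=> x xr i; have := xr i; rewrite ler_norml. Qed.

Lemma measurable_box (r : R) : measurable (box r : set E).
Proof. by rewrite boxE; exact: measurable_rect. Qed.

Definition rects : set (set E) := [set A | exists a b, A = rect a b].

Lemma bigcup_box : \bigcup_n (box n%:R : set E) = setT.
Proof.
apply/seteqP; split=> // x _.
exists (Num.truncn (\sum_(i < d) `|tnth x i|)).+1 => // i.
apply: le_trans (ltW (truncnS_gt _)).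
by rewrite (bigD1 i)//= lerDl sumr_ge0.
Qed.

(** A closed half-space [x_i <= t] is a countable union of growing rectangles, and an open one is a
    countable union of closed ones. The sets of reals whose preimage under a coordinate is generated
    by rectangles form a sigma-algebra containing the open rays, hence all Borel sets. *)
Lemma measurable_rects : @measurable _ E = <<s rects >>.
Proof.
apply/seteqP; split; last first.
  apply: smallest_sub; first exact: sigma_algebra_measurable.
  by move=> _ [a [b ->]]; exact: measurable_rect.
have mrays i (t : R) : <<s rects >> [set x : E | tnth x i <= t].
  have -> : [set x : E | tnth x i <= t] =
      \bigcup_n rect (fun=> - n%:R) (fun j => if j == i then t else n%:R).
    apply/seteqP; split=> [x xt|x [n _ /(_ i)]]; last first.
      by rewrite eqxx => /andP[].
    have := bigcup_box; rewrite -subTset => /(_ x I)[n _ xn].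
    exists n => // j; have := xn j; rewrite ler_norml => /andP[-> xjn] /=.
    by case: eqP => [->|].
  by apply: sigma_algebra_bigcup => n; apply: sub_sigma_algebra; do 2 eexists.
move=> A; apply; split; first exact: smallest_sigma_algebra.
rewrite -bigcup_seq => B [i _ [Y mY <-]]; rewrite setTI.
pose D := [set Z : set R | <<s rects >> ((fun x : E => tnth x i) @^-1` Z)].
suff : @measurable _ (measurableTypeR R) `<=` D by apply.
rewrite RGenInftyO.measurableE; apply: smallest_sub.
  split.
  - by rewrite /D/= preimage_set0; exact: sigma_algebra0.
  - move=> Z DZ; rewrite /D/= setTD preimage_setC.
    exact: sigma_algebraC.
  - move=> F DF; rewrite /D/= preimage_bigcup.
    exact: sigma_algebra_bigcup.
move=> _ [t ->]; rewrite /D/=.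
have -> : (fun x : E => tnth x i) @^-1` `]-oo, t[%classic =
    \bigcup_n [set x | tnth x i <= t - n.+1%:R^-1].
  apply/seteqP; split=> [x /=|x [n _] /= xt]; rewrite in_itv/=; last first.
    by rewrite (le_lt_trans xt)// ltrBlDr ltrDl invr_gt0 ltr0n.
  rewrite -subr_gt0 => xt; have [n _ Hn] := near_infty_natSinv_lt (PosNum xt).
  exists n => //=; rewrite lerBrDr addrC -lerBrDr; apply/ltW.
  exact: (Hn n (leqnn n)).
by apply: sigma_algebra_bigcup => n; exact: mrays.
Qed.

Lemma lam_rect a b : (forall i, a i <= b i) ->
  lam (rect a b) = (\prod_(i < d) (b i - a i))%:E.
Proof. exact: Hlam. Qed.

Lemma lam_box_lty n : (lam (box n%:R) < +oo)%E.
Proof. by rewrite boxE lam_rect ?ltry// => i; rewrite ge0_cp ?ler0n. Qed.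

Lemma sigma_finite_lam : sigma_finite setT lam.
Proof.
exists (fun n => box n%:R); first by rewrite bigcup_box.
by move=> n; split; [exact: measurable_box|exact: lam_box_lty].
Qed.

Definition translate c x : E := [tuple tnth x i + tnth c i | i < d].

Lemma measurable_translate c : measurable_fun setT (translate c).
Proof.
apply/measurable_fun_tnthP => i.
rewrite (_ : _ \o _ = fun x => tnth x i + tnth c i).
  by apply: measurable_funD => //; exact: measurable_tnth.
by apply/funext => x /=; rewrite tnth_mktuple.
Qed.

(** Uniqueness of measures: both sides agree on rectangles, which form an intersection-stable
    generator, and the boxes exhaust the space with finite measure. *)
Lemma lam_translate c A : measurable A -> pushforward lam (translate c) A = lam A.
Proof.
pose push : {measure set E -> \bar R} :=
  measure_function_pushforward__canonical__measure_function_Measure lam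
    (measurable_translate c).
apply: (@measure_unique _ _ _ rects (fun n => box n%:R) _ _ _ _ push lam).
- exact: measurable_rects.
- move=> _ _ [a [b ->]] [a' [b' ->]].
  exists (fun i => Num.max (a i) (a' i)), (fun i => Num.min (b i) (b' i)).
  apply/seteqP; split=> [x [xab xab'] i|x xab].
    have /andP[ax xb] := xab i; have /andP[ax' xb'] := xab' i.
    by rewrite ge_max ax ax' le_min xb xb'.
  split=> i; have := xab i; rewrite ge_max le_min;
    by move=> /andP[/andP[ax ax'] /andP[xb xb']]; apply/andP.
- by move=> n; rewrite boxE; do 2 eexists.
- exact: bigcup_box.
- move=> _ [a [b ->]]; rewrite /push/= /pushforward.
  have -> : translate c @^-1` rect a b =
      rect (fun i => a i - tnth c i) (fun i => b i - tnth c i).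
    apply/seteqP; split=> x xab i; have := xab i; rewrite tnth_mktuple.
      by rewrite lerBlDr lerBrDr.
    by rewrite lerBlDr lerBrDr.
  (* The volume formula is available only for ordered bounds; otherwise both rectangles are
     empty. *)
  have [ab|/existsNP[i /negP]] := pselect (forall i, a i <= b i).
    rewrite !lam_rect// => [|i]; last by rewrite lerD2r.
    by congr EFin; apply: eq_bigr => i _; rewrite opprB addrA subrK.
  rewrite -ltNge => bai.
  have rect0 a' b' : b' i < a' i -> rect a' b' = set0.
    move=> ba; apply/seteqP; split=> // x /(_ i) /andP[ax xb].
    by move: ba; rewrite ltNge (le_trans ax xb).
  by rewrite !rect0// ltrD2r.
- move=> n; rewrite /push/= /pushforward.
  have -> : translate c @^-1` box n%:R =
      rect (fun i => - n%:R - tnth c i) (fun i => n%:R - tnth c i).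
    rewrite boxE; apply/seteqP; split=> x xab i; have := xab i; rewrite tnth_mktuple.
      by rewrite lerBlDr lerBrDr.
    by rewrite lerBlDr lerBrDr.
  by rewrite lam_rect ?ltry// => i; rewrite lerD2r ge0_cp ?ler0n.
Qed.

Lemma integrable_translate c (F : E -> R) : lam.-integrable setT (EFin \o F) ->
  lam.-integrable setT (EFin \o (F \o translate c)) /\
  \int[lam]_x F (translate c x) = \int[lam]_x F x.
Proof.
move=> iF; have mT := measurable_translate c.
have mF : measurable_fun setT (EFin \o F) by exact: measurable_int iF.
have E1 G : measurable_fun setT G -> (forall x, 0 <= G x)%E ->
    (\int[lam]_x G (translate c x) = \int[lam]_x G x)%E.
  move=> mG G0; have := @ge0_integral_pushforward _ _ _ _ _ _ mT lam setT G measurableT mG.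
  rewrite preimage_setT => <-; last by move=> y _; exact: G0.
  apply: eq_measure_integral => A mA _; exact: lam_translate.
have iFT : lam.-integrable setT (EFin \o (F \o translate c)).
  move/integrableP : iF => [_ foo]; apply/integrableP; split.
    exact: (measurableT_comp mF mT).
  rewrite -(E1 (fun x => `|(F x)%:E|%E)) in foo => //.
  exact: measurableT_comp.
split=> //; rewrite /Rintegral; congr fine.
have := @integral_pushforward _ _ _ _ _ _ mT lam setT (EFin \o F) mF.
rewrite preimage_setT => /(_ iFT measurableT) <-.
apply: eq_measure_integral => A mA _; exact: lam_translate.
Qed.

End lebesgue.

(** * Weak gradients of Lipschitz functions *)

Section local_integrability.
Variables (R : realType) (d : nat).
Local Notation E := (d.-tuple R).
Variable lam : {measure set E -> \bar R}.
Hypothesis Hlam : is_lebesgue lam.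
Implicit Types (F G : E -> R) (b : 'I_d -> R -> R) (v : 'I_d -> R).

Lemma measurable_vnorm (G : 'I_d -> E -> R) :
  (forall i, measurable_fun setT (G i)) ->
  measurable_fun setT (fun x => vnorm (fun i => G i x)).
Proof.
move=> mG; apply: measurableT_comp.
  by apply: continuous_measurable_fun; exact: sqrt_continuous.
apply: measurable_sum => i; exact: measurable_funX.
Qed.

(** Boxes match the supports of tensor products, and the indicator keeps all integrals over the
    whole space. *)
Definition locally_int F :=
  forall r : R, lam.-integrable setT (EFin \o (fun x => F x * \1_(box r) x)).

Lemma measurable_indic_box (r : R) : measurable_fun setT (\1_(box r) : E -> R).
Proof. by apply: measurable_indic; exact: measurable_box. Qed.

Lemma locally_integrable_locally_int F : Defs.locally_integrable lam F -> locally_int F.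
Proof.
move=> lF r.
pose D := [set x : E | vnorm (tnth x) <= d%:R * r].
have mD : measurable D.
  have mv : measurable_fun setT (fun x : E => vnorm (tnth x)).
    by apply: (@measurable_vnorm (fun i x => tnth x i)) => i; exact: measurable_tnth.
  have := mv measurableT `]-oo, d%:R * r]%classic (measurable_itv _).
  rewrite setTI; set P := (X in measurable X -> _) => mP.
  suff -> : D = P by [].
  by apply/seteqP; split=> x; rewrite /D /P /= in_itv.
have mB : measurable (box r : set E) by exact: measurable_box.
have : lam.-integrable (box r) (EFin \o F).
  by apply: (integrableS mD mB) (lF _) => x; exact: box_vnorm.
move=> /(integrable_mkcond _ mB); apply: eq_integrable => // x _.
rewrite patchE /= indicE; case: ifP => _; by rewrite ?mulr1 ?mulr0.
Qed.

Lemma box_near (x : E) : \forall n \near \oo, box n%:R x.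
Proof.
have := bigcup_box R d; rewrite -subTset => /(_ x I)[n _ xn].
by exists n => // m nm i; rewrite (le_trans (xn i))// ler_nat.
Qed.

Lemma measurable_locally_int F : locally_int F -> measurable_fun setT F.
Proof.
move=> lF.
apply: (@measurable_fun_cvg _ _ _ _ (fun n x => F x * \1_(box n%:R) x)).
  by move=> n; exact: measurable_integrable (lF n%:R).
move=> x _; apply: cvg_near_cst; near=> n.
rewrite indicE mem_set ?mulr1//; near: n; exact: box_near.
Unshelve. all: by end_near. Qed.

Lemma integrable_locally_intM F G (r M : R) : locally_int F ->
  measurable_fun setT G -> (forall x, `|G x| <= M) ->
  (forall x, ~ box r x -> G x = 0) ->
  lam.-integrable setT (EFin \o (fun x => F x * G x)).
Proof.
move=> lF mG GM G0.
rewrite (_ : (fun x => F x * G x) = fun x => F x * \1_(box r) x * G x).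
  exact: integrable_mul_bounded (lF r) mG GM.
apply/funext => x; rewrite indicE; case: (pselect (box r x)) => xr.
  by rewrite mem_set ?mulr1.
by rewrite G0// !mulr0.
Qed.

Lemma locally_int_cst (c : R) : locally_int (cst c).
Proof.
move=> r; apply: (@integrable_scale _ _ _ lam c (\1_(box r))).
have mB : measurable (box r : set E) by exact: measurable_box.
apply/integrableP; split; first by apply/measurable_EFinP; exact: measurable_indic_box.
rewrite (_ : (\int[lam]_x _)%E = lam (box r)); last first.
  rewrite -[X in lam X]setIT -integral_indic//.
  by apply: eq_integral => x _; rewrite /= ger0_norm.
have := lam_box_lty Hlam (Num.truncn r).+1; apply: le_lt_trans.
apply: le_measure; rewrite ?inE; do ?exact: measurable_box.
by move=> x xr i; rewrite (le_trans (xr i))// ltW// truncnS_gt.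
Qed.

Lemma locally_intM F G : locally_int F -> econtinuous G ->
  locally_int (fun x => F x * G x).
Proof.
move=> lF cG r; have [M M0 HM] := econtinuous_bounded r cG.
rewrite (_ : (fun x => _) = fun x => F x * (G x * \1_(box r) x)); last first.
  by apply/funext => x; rewrite mulrA.
apply: (@integrable_locally_intM _ _ r M) => //.
- apply: measurable_funM; first exact: econtinuous_measurable.
  exact: measurable_indic_box.
- move=> x; rewrite indicE; case: (pselect (box r x)) => xr.
    by rewrite mem_set ?mulr1 ?HM.
  by rewrite memNset ?mulr0 ?normr0.
- by move=> x xr; rewrite indicE memNset ?mulr0.
Qed.

Lemma econtinuous_locally_int G : econtinuous G -> locally_int G.
Proof.
move=> cG; rewrite (_ : G = fun x => cst 1 x * G x).
  by apply: locally_intM => //; exact: locally_int_cst.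
by apply/funext => x; rewrite mul1r.
Qed.

Lemma integrable_locally_int_tens F b r : locally_int F -> tsmooth b -> tsupp b r ->
  lam.-integrable setT (EFin \o (fun x => F x * tens b x)).
Proof.
move=> lF sb rb; have [M _ HM] := tens_bounded sb rb.
apply: (integrable_locally_intM (r := r) lF _ HM).
  by apply: econtinuous_measurable; exact: econtinuous_tens.
by move=> x; exact: tens_eq0.
Qed.

Lemma integrable_tens b r : tsmooth b -> tsupp b r ->
  lam.-integrable setT (EFin \o tens b).
Proof.
move=> sb rb; have := integrable_locally_int_tens (locally_int_cst 1) sb rb.
by apply: eq_integrable => // x _ /=; rewrite mul1r.
Qed.

Lemma weak_gradient_tens f (Gf : 'I_d -> E -> R) b (r : R) i :
  weak_gradient lam f Gf -> tsmooth b -> tsupp b r ->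
  \int[lam]_x (f x * tens (dtens b i) x) = - \int[lam]_x (Gf i x * tens b x).
Proof.
move=> [_ [_ H]] sb rb.
by rewrite /Rintegral -pd_tens// (H _ (test_fun_tens sb rb)) fineN.
Qed.

(** The factors of the translate of [tens b] by [s v]; the coefficient [1] gives them the affine
    shape covered by [smooth1_affine]. *)
Definition shift_factors b v (s : R) : 'I_d -> R -> R :=
  fun j t => b j (1 * t + s * v j).

Lemma tens_shift_factors b v s x : tens (shift_factors b v s) x = tens b (line x v s).
Proof. by apply: eq_bigr => j _; rewrite tnth_mktuple /shift_factors mul1r. Qed.

Lemma tsmooth_shift_factors b v s : tsmooth b -> tsmooth (shift_factors b v s).
Proof. by move=> sb j; exact: smooth1_affine. Qed.

Lemma tsupp_shift_factors b v s r : `|s| <= 1 -> tsupp b r ->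
  tsupp (shift_factors b v s) (r + vnorm v).
Proof.
move=> s1 rb j t rt; apply: rb; rewrite mul1r.
have : `|t| <= `|t + s * v j| + `|s * v j| by rewrite -{1}[t](addrK (s * v j)) ler_normB.
have : `|s * v j| <= vnorm v.
  by rewrite normrM (le_trans _ (ler_vnorm v j))// ler_piMl.
lra.
Qed.

(** Mean value theorem along the line, with the suprema of the partial derivatives. The constant is
    uniform in [x], which provides the domination of the difference quotients of the test
    function. *)
Lemma tens_line_le b v r : tsmooth b -> tsupp b r ->
  exists2 M, 0 <= M & forall x (s : R), `|tens b (line x v s) - tens b x| <= M * `|s|.
Proof.
move=> sb rb.
have /choice[m Hm] (i : 'I_d) :
    exists M : R, 0 <= M /\ forall x, `|tens (dtens b i) x| <= M.
  have [M M0 HM] := tens_bounded (tsmooth_dtens i sb) (tsupp_dtens i rb).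
  by exists M.
exists (\sum_(i < d) `|v i| * m i).
  by apply: sumr_ge0 => i _; rewrite mulr_ge0//; have [] := Hm i.
move=> x s.
have gd t := is_derive_tens_line x v t sb.
have x0 : line x v 0 = x by apply: eq_from_tnth => i; rewrite tnth_mktuple mul0r addr0.
have cont A : {within A, continuous (fun u => tens b (line x v u))}.
  apply: continuous_subspaceT => u.
  apply/differentiable_continuous/derivable1_diffP.
  by case: (gd u).
have [c Hc] : exists c, tens b (line x v s) - tens b x =
    (\sum_(i < d) v i * tens (dtens b i) (line x v c)) * s.
  have [s0|s0|->] := ltgtP s 0.
  - have [c _ Hc] := MVT s0 (fun t _ => gd t) (cont _).
    exists c; apply: oppr_inj; rewrite opprB.
    by move: Hc; rewrite x0 => ->; ring.
  - have [c _ Hc] := MVT s0 (fun t _ => gd t) (cont _).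
    by exists c; move: Hc; rewrite x0 subr0.
  - by exists 0; rewrite x0 subrr mulr0.
rewrite Hc normrM ler_wpM2r// (le_trans (ler_norm_sum _ _ _))//.
by apply: ler_sum => i _; rewrite normrM ler_wpM2l//; have [] := Hm i.
Qed.

(* Moving the difference quotient of the test function onto [u] replaces
   the directional derivative of [u] by a quantity bounded through the
   Lipschitz constant; no differentiability of [u] is involved. *)
Lemma lipschitz_weak_gradient_le u (Gu : 'I_d -> E -> R) (C r : R) v b :
  weak_gradient lam u Gu -> lipschitz_with C u ->
  tsmooth b -> tsupp b r -> (forall x, 0 <= tens b x) ->
  \sum_(i < d) v i * \int[lam]_x (Gu i x * tens b x) <=
  C * vnorm v * \int[lam]_x tens b x.
Proof.
move=> wu Lu sb rb b0.
have cu := lipschitz_econtinuous Lu.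
have lu := econtinuous_locally_int cu.
pose t n : R := n.+1%:R^-1.
have t0 n : 0 < t n by rewrite invr_gt0 ltr0n.
have t1 n : `|- t n| <= 1 by rewrite normrN gtr0_norm// /t invf_le1 ?ltr0n// ler1n.
pose bn n := shift_factors b v (- t n).
have sbn n : tsmooth (bn n) by exact: tsmooth_shift_factors.
have rbn n : tsupp (bn n) (r + vnorm v) by exact: tsupp_shift_factors.
(* The step is [- t n], so [D n] tends to [L], which is [u] times minus the derivative of [tens b]
   along [v]. By the weak gradient, the integral of [L] is the left-hand side with its sign. *)
pose D n y := u y * ((tens (bn n) y - tens b y) / t n).
pose L y := u y * - (\sum_(i < d) v i * tens (dtens b i) y).
have [M M0 HM] := tens_line_le v sb rb.
have ibn n := integrable_locally_int_tens lu (sbn n) (rbn n).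
have ib := integrable_locally_int_tens lu sb rb.
have DE n : D n = fun y => (t n)^-1 * (u y * tens (bn n) y - u y * tens b y).
  by apply/funext => y; rewrite /D; ring.
have iB n : lam.-integrable setT
    (EFin \o (fun y => u y * tens (bn n) y - u y * tens b y)).
  exact: (integrableB measurableT (ibn n) ib).
have [_ DL] : lam.-integrable setT (EFin \o L) /\
    \int[lam]_x D n x @[n --> \oo] --> \int[lam]_x L x.
  (* Steps of size at most 1 keep all the translated supports inside one box, so the dominating
     function does not depend on [n]. *)
  pose B := r + vnorm v.
  apply: (@dominated_Rintegral _ _ _ lam D L (fun y => M * `|u y * \1_(box B) y|)).
  - move=> n; rewrite DE; apply: measurable_funM => //.
    exact: measurable_integrable (iB n).
  - move=> y; apply: cvgM; first exact: cvg_cst.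
    have x0 : line y v 0 = y by apply: eq_from_tnth => i; rewrite tnth_mktuple mul0r addr0.
    have := is_derive_tens_line y v 0 sb; rewrite x0 => -[dg <-].
    have tn0 : - t n @[n --> \oo] --> (0 : R)^'.
      have tN0 : - t n @[n --> \oo] --> (0 : R).
        by rewrite -[X in _ --> X]oppr0; apply: cvgN; exact: cvg_harmonic.
      move=> A HA.
      have HA' : \forall n \near \oo, - t n != 0 -> A (- t n) := tN0 _ HA.
      have nz n : - t n != 0 by rewrite oppr_eq0 gt_eqF.
      by apply: filterS HA' => n; apply.
    have := cvg_comp _ _ tn0 dg.
    move=> /cvgN; apply: cvg_trans; apply: near_eq_cvg; near=> n => /=.
    transitivity (- ((- t n)^-1 *
      (tens b (line y v (- t n * 1 + 0)) - tens b (line y v 0)))) => //.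
    by rewrite mulr1 addr0 x0 /bn tens_shift_factors invrN mulNr opprK mulrC.
  - by apply: integrable_scale; exact: integrable_norm (lu B).
  - move=> n y; rewrite /D indicE.
    have [yB|yB] := pselect (box B y).
      rewrite mem_set// mulr1 normrM mulrC ler_wpM2r//.
      rewrite normrM normfV [`|t n|]gtr0_norm// ler_pdivrMr//.
      rewrite /bn tens_shift_factors (le_trans (HM _ _))// normrN gtr0_norm//.
    rewrite (tens_eq0 (rbn n) yB) (tens_eq0 rb).
      by rewrite subrr mul0r mulr0 normr0 mulr_ge0.
    by move=> yr; apply: yB => i; rewrite (le_trans (yr i))// lerDl vnorm_ge0.
have iG i : lam.-integrable setT (EFin \o (fun x => Gu i x * tens b x)).
  apply: integrable_locally_int_tens sb rb.
  by apply: locally_integrable_locally_int; case: wu => _ [].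
have id i := integrable_locally_int_tens lu (tsmooth_dtens i sb) (tsupp_dtens i rb).
have LE : \int[lam]_x L x = \sum_(i < d) v i * \int[lam]_x (Gu i x * tens b x).
  transitivity (\int[lam]_x (\sum_(i < d) - v i * (u x * tens (dtens b i) x))).
    apply: eq_Rintegral => x _; rewrite /L -sumrN mulr_sumr.
    by apply: eq_bigr => i _; ring.
  rewrite Rintegral_bigsum => [|i]; last exact: integrable_scale.
  apply: eq_bigr => i _; rewrite RintegralZl//.
  by rewrite (weak_gradient_tens i wu sb rb) mulrNN.
rewrite -LE.
apply: (ler_cvg_to DL (cvg_cst _)); near=> n.
rewrite DE RintegralZl// RintegralB//.
(* Translating by [t v] turns [u(y) b(y - t v)] into [u(y + t v) b(y)]. The integrand becomes an
   increment of [u], at most [C t |v|], times the nonnegative [tens b]. *)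
pose c : E := [tuple t n * v i | i < d].
have cE y : line (translate c y) v (- t n) = y.
  by apply: eq_from_tnth => i; rewrite !tnth_mktuple; ring.
have [iT <-] := integrable_translate Hlam c (ibn n).
have tcE y : tens (bn n) (translate c y) = tens b y.
  by rewrite /bn tens_shift_factors cE.
rewrite -RintegralB// ler_pdivrMl//.
have itens := integrable_tens sb rb.
rewrite [leRHS]mulrA -RintegralZl//.
apply: le_Rintegral => //.
- have := integrableB measurableT iT ib.
  by apply: eq_integrable.
- exact: integrable_scale.
move=> y _; rewrite /comp tcE -mulrBl ler_wpM2r//.
apply: (le_trans (ler_norm _)); apply: (le_trans (Lu _ _)).
rewrite mulrCA (_ : Defs.edist _ _ = t n * vnorm v)//.
rewrite -{1}[t n]gtr0_norm// -vnormZ /Defs.edist; congr vnorm.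
by apply/funext => i; rewrite !tnth_mktuple addrC addKr.
Unshelve. all: by end_near. Qed.

End local_integrability.

(** * Mollification *)

Section kernel.
Variables (R : realType) (d : nat).
Local Notation E := (d.-tuple R).
Implicit Types (x y : E) (e r : R).

(** This is [bump ((t - x_j) / e)], written as an affine function of [t] so that smoothness and
    derivatives follow from the affine lemmas. *)
Definition ker_factors e x : 'I_d -> R -> R :=
  fun j t => bump (e^-1 * t + - (e^-1 * tnth x j)).

Definition ker e x y : R := tens (ker_factors e x) y.

Lemma tsmooth_ker_factors e x : tsmooth (ker_factors e x).
Proof. by move=> j; apply: smooth1_affine; exact: smooth1_bump. Qed.

Lemma bump_scaled_eq0 e (s t : R) : 0 < e -> e <= `|s - t| ->
  bump (e^-1 * s + - (e^-1 * t)) = 0.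
Proof.
move=> e0 st; apply: bump_eq0; rewrite -mulrBr normrM normfV [`|e|]gtr0_norm//.
by rewrite ler_pdivlMl// mulr1.
Qed.

Lemma tsupp_ker_factors e x r : 0 < e -> box r x -> tsupp (ker_factors e x) (r + e).
Proof.
move=> e0 xr j t rt; apply: bump_scaled_eq0 => //.
have := xr j; have := lerB_dist t (tnth x j); lra.
Qed.

Lemma kerC e x y : ker e x y = ker e y x.
Proof.
apply: eq_bigr => j _; rewrite /ker_factors -bumpN; congr bump; ring.
Qed.

Lemma ker_ge0 e x y : 0 <= ker e x y.
Proof. by apply: tens_ge0 => j t; exact: bump_ge0. Qed.

Lemma ker_le1 e x y : `|ker e x y| <= 1.
Proof.
rewrite ger0_norm ?ker_ge0//; apply: prodr_ile1 => j _.
by rewrite bump_ge0 bump_le1.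
Qed.

Lemma ker_eq0 e x y i : 0 < e -> e <= `|tnth y i - tnth x i| -> ker e x y = 0.
Proof.
by move=> e0 xy; rewrite /ker /tens (bigD1 i)//= {1}/ker_factors bump_scaled_eq0// mul0r.
Qed.

(** The margin 1 does not depend on [e], so one box serves all scales of mollification. *)
Lemma ker_out e r x y : 0 < e <= 1 -> box r x -> ~ box (r + 1) y -> ker e x y = 0.
Proof.
move=> /andP[e0 e1] xr yr; apply: (tens_eq0 (tsupp_ker_factors e0 xr)).
by move=> yre; apply: yr => i; rewrite (le_trans (yre i))// lerD2l.
Qed.

(* The derivative of [ker e] with respect to [x_i]. *)
Definition dker e i x y : R := tens (dtens (ker_factors e y) i) x.

Lemma derive1_ker_factors e x i (t : R) : derive1 (ker_factors e x i) t =
  e^-1 * derive1 (@bump R) (e^-1 * t + - (e^-1 * tnth x i)).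
Proof.
rewrite [LHS]derive1E; apply: derive_val.
by apply: is_derive_affine; apply: smooth1_is_derive; exact: smooth1_bump.
Qed.

Lemma derive1_bumpN (t : R) : derive1 (@bump R) (- t) = - derive1 (@bump R) t.
Proof.
have : is_derive t 1 (fun u : R => bump (-1 * u + 0)) (-1 * derive1 (@bump R) (-1 * t + 0)).
  by apply: is_derive_affine; apply: smooth1_is_derive; exact: smooth1_bump.
rewrite (_ : (fun u => _) = @bump R); last first.
  by apply/funext => u; rewrite mulN1r addr0 bumpN.
move=> [_]; rewrite -derive1E => ->.
by rewrite !mulN1r addr0 opprK.
Qed.

(** The kernel depends on [x - y] and the derivative of the even bump is odd. This sign rule
    transfers a derivative in the variable of [u] to the variable of [f]. *)
Lemma dkerN e i x y : tens (dtens (ker_factors e x) i) y = - dker e i x y.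
Proof.
rewrite /dker !tens_dtens !derive1_ker_factors -[RHS]mulNr; congr (_ * _).
  by rewrite -[RHS]mulrN -derive1_bumpN; congr (_ * derive1 (@bump R) _); ring.
apply: eq_bigr => j _; rewrite /ker_factors -bumpN; congr bump; ring.
Qed.

Lemma dker_out e r i x y : 0 < e <= 1 -> box r x -> ~ box (r + 1) y ->
  dker e i x y = 0.
Proof.
move=> /andP[e0 e1] xr yr; apply: oppr_inj; rewrite -dkerN oppr0.
apply: (tens_eq0 (tsupp_dtens i (tsupp_ker_factors e0 xr))).
by move=> yre; apply: yr => j; rewrite (le_trans (yre j))// lerD2l.
Qed.

Lemma measurable_bump_diff (g : R -> R) e j : continuous g ->
  measurable_fun setT (fun z : E * E => g (e^-1 * tnth z.1 j + - (e^-1 * tnth z.2 j))).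
Proof.
move=> cg; apply: measurableT_comp; first exact: continuous_measurable_fun.
apply: measurable_funD; last apply: measurableT_comp => //;
  apply: measurable_funM => //;
  by apply: (measurableT_comp (measurable_tnth j)).
Qed.

Lemma measurable_ker e : measurable_fun setT (fun z : E * E => ker e z.1 z.2).
Proof.
rewrite (_ : (fun z => _) = fun z => ker e z.2 z.1); last first.
  by apply/funext => z; rewrite kerC.
apply: measurable_prod => j _; apply: measurable_bump_diff.
by apply: smooth1_continuous; exact: smooth1_bump.
Qed.

Lemma measurable_dker e i : measurable_fun setT (fun z : E * E => dker e i z.1 z.2).
Proof.
rewrite /dker; under eq_fun do rewrite tens_dtens derive1_ker_factors big_mkcond.
apply: measurable_funM; last first.
  apply: measurable_prod => j _; case: (j != i) => //.
  apply: measurable_bump_diff.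
  by apply: smooth1_continuous; exact: smooth1_bump.
apply: measurable_funM => //; apply: measurable_bump_diff.
by apply: smooth1_continuous; apply: smooth1_derive; exact: smooth1_bump.
Qed.

Lemma derive1_bump_bounded : exists2 M, 0 <= M &
  forall t : R, `|derive1 (@bump R) t| <= M.
Proof.
have cb : continuous (derive1 (@bump R)).
  by apply: smooth1_continuous; apply: smooth1_derive; exact: smooth1_bump.
have cK : compact (derive1 (@bump R) @` `[-2, 2]%classic).
  apply: continuous_compact; first exact: continuous_subspaceT.
  exact: segment_compact.
have [M [_ HM]] := compact_bounded cK.
exists (`|M| + 1); first by rewrite addr_ge0.
move=> t; have [t2|t2] := leP `|t| 2.
  apply: (HM (`|M| + 1)); first by rewrite (le_lt_trans (ler_norm _))// ltrDl.
  by exists t => //=; rewrite in_itv/= -ler_norml.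
rewrite derive1E (_ : 'D_1 _ t = 0) ?normr0 ?addr_ge0//.
apply: derive_val; apply: (@near_eq_is_derive _ _ _ (cst 0)).
near=> u; apply/esym/bump_eq0.
near: u; have : `|u| @[u --> t] --> `|t| by exact: norm_continuous.
by move=> /(cvgr_ge _); apply; lra.
Unshelve. all: by end_near. Qed.

(** Only the differentiated factor contributes [e^-1]; the others lie between 0 and 1. For a fixed
    small [e] this is the bound needed by Fubini, and for [e = n+1] it is the decay of the gradients
    of the cutoffs. *)
Lemma dker_bounded : exists2 M, 0 <= M &
  forall e i x y, `|dker e i x y| <= `|e^-1| * M.
Proof.
have [M M0 HM] := derive1_bump_bounded.
exists M => // e i x y; rewrite /dker tens_dtens derive1_ker_factors !normrM.
rewrite -[leRHS]mulr1; apply: ler_pM => //; first by rewrite ler_wpM2l.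
rewrite ger0_norm; last by apply: prodr_ge0 => j _; exact: bump_ge0.
by apply: prodr_ile1 => j _; rewrite bump_ge0 bump_le1.
Qed.

End kernel.

Section mollification.
Variables (R : realType) (d : nat).
Local Notation E := (d.-tuple R).
Variable lam : {measure set E -> \bar R}.
Hypothesis Hlam : is_lebesgue lam.
Implicit Types (x y : E) (e r : R) (q A : E -> R).

(** Since [A] lives in a box and [k] has bounded range, [q] may be truncated to the box enlarged by
    1 without changing any integral; the truncation is integrable, and the global version
    applies. *)
Lemma fubini_local A q (k : E -> E -> R) (M r : R) :
  lam.-integrable setT (EFin \o A) -> (forall x, ~ box r x -> A x = 0) ->
  locally_int lam q -> measurable_fun setT (fun z => k z.1 z.2) -> (forall x y, `|k x y| <= M) ->
  (forall x y, box r x -> ~ box (r + 1) y -> k x y = 0) ->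
  [/\ lam.-integrable setT (EFin \o (fun x => A x * \int[lam]_y (q y * k x y))),
      lam.-integrable setT (EFin \o (fun y => q y * \int[lam]_x (A x * k x y))) &
      \int[lam]_x (A x * \int[lam]_y (q y * k x y)) =
      \int[lam]_y (q y * \int[lam]_x (A x * k x y))].
Proof.
move=> iA A0 lq mk kM k0; pose B y := q y * \1_(box (r + 1)) y.
have AE : (fun x => A x * \int[lam]_y (B y * k x y)) =
    (fun x => A x * \int[lam]_y (q y * k x y)).
  apply/funext => x; case: (pselect (box r x)) => xr; last by rewrite A0// !mul0r.
  congr (_ * _); apply: eq_Rintegral => y _; rewrite /B indicE.
  case: (pselect (box (r + 1) y)) => yr; first by rewrite mem_set ?mulr1.
  by rewrite k0// !mulr0.
have BE : (fun y => B y * \int[lam]_x (A x * k x y)) =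
    (fun y => q y * \int[lam]_x (A x * k x y)).
  apply/funext => y; rewrite /B indicE; case: (pselect (box (r + 1) y)) => yr.
    by rewrite mem_set ?mulr1.
  rewrite (_ : (fun x => A x * k x y) = cst 0).
    by rewrite Rintegral_cst// mul0r !mulr0.
  apply/funext => x; case: (pselect (box r x)) => xr; last by rewrite A0// mul0r.
  by rewrite k0// mulr0.
have mk' : measurable_fun setT (fun z : E * E => k z.2 z.1).
  have ms : measurable_fun setT (fun z : E * E => (z.2, z.1)).
    exact: measurable_swap.
  exact: (measurableT_comp mk ms).
have sf := sigma_finite_lam Hlam.
have [i1 e1] := fubini_kernel sf iA (lq (r + 1)) mk (fun z => kM z.1 z.2).
have [i2 _] := fubini_kernel sf (lq (r + 1)) iA mk' (fun z => kM z.2 z.1).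
rewrite -AE -BE; move: i1 i2 e1 => /= i1 i2 e1.
split; [exact: i1|exact: i2|exact: e1].
Qed.

Definition kmass e : R := \int[lam]_y ker e [tuple 0 | _ < d] y.

Lemma box_ex x : exists r, box r x.
Proof. by have := bigcup_box R d; rewrite -subTset => /(_ x I)[n _ xn]; exists n%:R. Qed.

Lemma integrable_ker e x : 0 < e -> lam.-integrable setT (EFin \o ker e x).
Proof.
move=> e0; have [r xr] := box_ex x.
exact: (integrable_tens Hlam (tsmooth_ker_factors e x) (tsupp_ker_factors e0 xr)).
Qed.

Lemma int_ker e x : 0 < e -> \int[lam]_y ker e x y = kmass e.
Proof.
move=> e0; rewrite /kmass; pose c : E := [tuple - tnth x i | i < d].
have [_ <-] := integrable_translate Hlam c (integrable_ker [tuple 0 | _ < d] e0).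
apply: eq_Rintegral => y _; apply: eq_bigr => j _.
by rewrite /ker_factors !tnth_mktuple; congr bump; ring.
Qed.

(** On the cube of side [e] around the origin every factor is at least [c], by [bump_ge_half], and
    that cube has positive volume. *)
Lemma kmass_gt0 e : 0 < e -> 0 < kmass e.
Proof.
move=> e0; pose c : R := expR (- 2) * expR (- 2).
have c0 : 0 < c by rewrite mulr_gt0 ?expR_gt0.
have ik := integrable_ker [tuple 0 | _ < d] e0.
have mB : measurable (box (e / 2) : set E) by exact: measurable_box.
have lB : lam (box (e / 2)) = (\prod_(i < d) e)%:E.
  rewrite boxE (lam_rect Hlam) => [|i]; last by lra.
  by congr EFin; apply: eq_bigr => i _; lra.
have icB : lam.-integrable setT (EFin \o (fun y => c ^+ d * \1_(box (e / 2)) y)).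
  apply: integrable_scale; have := locally_int_cst Hlam 1 (e / 2).
  by apply: eq_integrable => // y _ /=; rewrite mul1r.
apply: (@lt_le_trans _ _ (\int[lam]_y (c ^+ d * \1_(box (e / 2)) y))).
  rewrite RintegralZl//; last first.
    have := locally_int_cst Hlam 1 (e / 2).
    by apply: eq_integrable => // y _ /=; rewrite mul1r.
  rewrite mulr_gt0 ?exprn_gt0// /Rintegral integral_indic// setIT lB /=.
  by apply: prodr_gt0.
apply: le_Rintegral => // y _; rewrite indicE.
case: (pselect (box (e / 2) y)) => yB; last by rewrite memNset ?mulr0 ?ker_ge0.
rewrite mem_set// mulr1 -[X in _ ^+ X]card_ord -prodr_const.
apply: ler_prod => j _; rewrite ltW//=.
apply: bump_ge_half; rewrite tnth_mktuple mulr0 subr0 normrM normfV [`|e|]gtr0_norm//.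
by have := yB j; rewrite ler_pdivrMl//; lra.
Qed.

Definition eps n : R := n.+1%:R^-1.

Lemma eps_gt0 n : 0 < eps n.
Proof. by rewrite invr_gt0 ltr0n. Qed.

Lemma eps_itv n : 0 < eps n <= 1.
Proof. by rewrite eps_gt0 /eps invf_le1 ?ltr0n// ler1n. Qed.

Definition mollify q n x : R :=
  (kmass (eps n))^-1 * \int[lam]_y (q y * ker (eps n) x y).

Lemma integrable_mul_ker q n x : locally_int lam q ->
  lam.-integrable setT (EFin \o (fun y => q y * ker (eps n) x y)).
Proof.
move=> lq; have [r xr] := box_ex x.
exact: (integrable_locally_int_tens lq (tsmooth_ker_factors _ x)
  (tsupp_ker_factors (eps_gt0 n) xr)).
Qed.

Lemma mollify_le q n x (M r : R) : locally_int lam q -> box r x ->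
  (forall y, box (r + 1) y -> `|q y| <= M) -> `|mollify q n x| <= M.
Proof.
move=> lq xr qM; have k0 := kmass_gt0 (eps_gt0 n).
rewrite /mollify normrM normfV [`|kmass _|]gtr0_norm// ler_pdivrMl//.
have iqk := integrable_mul_ker n x lq.
apply: (le_trans (le_normr_Rintegral _ iqk)) => //.
rewrite -(int_ker x (eps_gt0 n)) mulrC -RintegralZl//; last exact: integrable_ker (eps_gt0 n).
apply: le_Rintegral => //.
- exact: integrable_norm.
- by apply: integrable_scale; exact: integrable_ker (eps_gt0 n).
move=> y _; rewrite normrM [`|ker _ _ _|]ger0_norm ?ker_ge0//.
case: (pselect (box (r + 1) y)) => yr; first by rewrite ler_wpM2r ?ker_ge0// qM.
by rewrite (ker_out (eps_itv n) xr yr) !mulr0.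
Qed.

Lemma mollify_cvg q x : econtinuous q -> mollify q n x @[n --> \oo] --> q x.
Proof.
move=> cq; apply/cvgrPdist_le => eta eta0.
have lq := econtinuous_locally_int Hlam cq.
have [del del0 Hdel] := cq x eta eta0.
have en : eps n @[n --> \oo] --> (0 : R) by exact: cvg_harmonic.
near=> n.
have e0 := eps_gt0 n; have k0 := kmass_gt0 e0.
(* The kernel lives in a cube of half-side [eps n], which then lies in the euclidean ball of radius
   [del]. *)
have epsd : eps n < del / d.+1%:R.
  rewrite -[eps n]gtr0_norm//; near: n.
  by move/cvgr0Pnorm_lt : en; apply; rewrite divr_gt0// ltr0n.
have iqk := integrable_mul_ker n x lq.
have ik := integrable_ker x e0.
have -> : q x - mollify q n x =
    (kmass (eps n))^-1 * \int[lam]_y (q x * ker (eps n) x y - q y * ker (eps n) x y).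
  rewrite RintegralB//; last exact: integrable_scale.
  rewrite RintegralZl// int_ker// mulrBr; congr (_ - _).
  by rewrite mulrCA mulVf ?mulr1// gt_eqF.
have iB : lam.-integrable setT
    (EFin \o (fun y => q x * ker (eps n) x y - q y * ker (eps n) x y)).
  exact: (integrableB measurableT (integrable_scale (q x) ik) iqk).
rewrite normrM normfV [`|kmass _|]gtr0_norm// ler_pdivrMl//.
apply: (le_trans (le_normr_Rintegral _ iB)) => //.
rewrite -(int_ker x e0) mulrC -RintegralZl//.
apply: le_Rintegral => //.
- exact: integrable_norm.
- exact: integrable_scale.
move=> y _; rewrite -mulrBl normrM [`|ker _ _ _|]ger0_norm ?ker_ge0//.
case: (pselect (forall i, `|tnth y i - tnth x i| < eps n)) => [xy|].
  rewrite ler_wpM2r ?ker_ge0// distrC ltW// Hdel//.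
  by apply: edist_lt => // i; rewrite (lt_trans (xy i)).
by move=> /existsNP[i /negP]; rewrite -leNgt => /(ker_eq0 e0) ->; rewrite !mulr0.
Unshelve. all: by end_near. Qed.

(** The mollified factor is the continuous one: it converges pointwise and is bounded on the box of
    [A] by the supremum of [|q|] on a slightly larger box. Dominated convergence then asks only
    integrability of [A]. *)
Lemma mollify_integral_cvg A q r : lam.-integrable setT (EFin \o A) ->
  (forall x, ~ box r x -> A x = 0) -> econtinuous q ->
  (forall n, lam.-integrable setT (EFin \o (fun x => A x * mollify q n x))) /\
  \int[lam]_x (A x * mollify q n x) @[n --> \oo] --> \int[lam]_x (A x * q x).
Proof.
move=> iA A0 cq; have lq := econtinuous_locally_int Hlam cq.
have iAm n : lam.-integrable setT (EFin \o (fun x => A x * mollify q n x)).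
  have [iF _ _] := fubini_local iA A0 lq (measurable_ker (eps n))
    (ker_le1 (eps n)) (fun x y => ker_out (eps_itv n)).
  have := integrable_scale (kmass (eps n))^-1 iF.
  by apply: eq_integrable => // x _; rewrite /= /mollify; congr EFin; ring.
split=> //.
have [M M0 HM] := econtinuous_bounded (r + 1) cq.
apply: (dominated_Rintegral (H := fun x => M * `|A x|) _ _ _ _).2.
- by move=> n; exact: measurable_integrable (iAm n).
- by move=> x; apply: cvgM; [exact: cvg_cst|exact: mollify_cvg].
- by apply: integrable_scale; exact: integrable_norm.
move=> n x; case: (pselect (box r x)) => xr; last by rewrite A0// mul0r normr0 mulr0.
by rewrite normrM mulrC ler_wpM2r//; exact: mollify_le lq xr HM.
Qed.

End mollification.

(** * Integration by parts *)

Section weighted_inequality.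
Variables (R : realType) (d : nat).
Local Notation E := (d.-tuple R).
Variable lam : {measure set E -> \bar R}.
Hypothesis Hlam : is_lebesgue lam.
Variables (w : E -> R) (u : E -> R) (Gu : 'I_d -> E -> R) (C : R).
Hypothesis cw : econtinuous w.
Hypothesis w0 : forall x, 0 <= w x.
Hypothesis wu : weak_gradient lam u Gu.
Hypothesis Lu : lipschitz_with C u.

Let lGu i : locally_int lam (Gu i).
Proof. by apply: locally_integrable_locally_int; case: wu => _ []. Qed.

Let lw : locally_int lam w.
Proof. exact: econtinuous_locally_int. Qed.

(* [w] is merely continuous, so [tens b * w] is not a test function: it is
   approximated by superpositions of the test functions
   [tens b * ker e z] with weights [w z]. *)
Lemma lipschitz_weak_gradient_weight_le (v : 'I_d -> R) b (r : R) :
  tsmooth b -> tsupp b r -> (forall x, 0 <= tens b x) ->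
  \sum_(i < d) v i * \int[lam]_x (Gu i x * tens b x * w x) <=
  C * vnorm v * \int[lam]_x (tens b x * w x).
Proof.
move=> sb rb b0.
pose A x := \sum_(i < d) v i * (Gu i x * tens b x).
have iG i := integrable_locally_int_tens (lGu i) sb rb.
have iA : lam.-integrable setT (EFin \o A).
  by apply: integrable_bigsum => i; exact: integrable_scale.
have ib := integrable_tens Hlam sb rb.
have A0 x : ~ box r x -> A x = 0.
  move=> xr; rewrite /A big1// => i _.
  by rewrite (tens_eq0 rb xr) !mulr0.
have b0' x : ~ box r x -> tens b x = 0 by exact: tens_eq0.
have [iAm cA] := mollify_integral_cvg Hlam iA A0 cw.
have [ibm cb] := mollify_integral_cvg Hlam ib b0' cw.
have iGw i : lam.-integrable setT (EFin \o (fun x => Gu i x * tens b x * w x)).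
  have := integrable_locally_int_tens (locally_intM (lGu i) cw) sb rb.
  by apply: eq_integrable => // x _; rewrite /= mulrAC.
have <- : \int[lam]_x (A x * w x) =
    \sum_(i < d) v i * \int[lam]_x (Gu i x * tens b x * w x).
  transitivity (\int[lam]_x (\sum_(i < d) v i * (Gu i x * tens b x * w x))).
    apply: eq_Rintegral => x _; rewrite /A mulr_suml.
    by apply: eq_bigr => i _; ring.
  rewrite Rintegral_bigsum => [|i]; last exact: integrable_scale.
  by apply: eq_bigr => i _; rewrite RintegralZl.
apply: (ler_cvg_to cA (cvgM (cvg_cst _) cb)); near=> n.
have km := kmass_gt0 Hlam (eps_gt0 R n).
have mE B : lam.-integrable setT (EFin \o B) -> (forall x, ~ box r x -> B x = 0) ->
    lam.-integrable setT (EFin \o (fun y => w y * \int[lam]_x (B x * ker (eps R n) x y))) /\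
    \int[lam]_x (B x * mollify lam w n x) = (kmass lam (eps R n))^-1 *
    \int[lam]_y (w y * \int[lam]_x (B x * ker (eps R n) x y)).
  move=> iB B0.
  have [i1 i2 e1] := fubini_local Hlam iB B0 lw (measurable_ker (eps R n))
    (ker_le1 (eps R n)) (fun x y => ker_out (eps_itv R n)).
  split; [exact: i2|rewrite -e1 -RintegralZl; [|exact: measurableT|exact: i1]].
  by apply: eq_Rintegral => x _; rewrite /mollify mulrCA.
suff : \int[lam]_x (A x * mollify lam w n x) <=
    C * vnorm v * \int[lam]_x (tens b x * mollify lam w n x) by [].
have [iA2 ->] := mE _ iA A0; have [ib2 ->] := mE _ ib b0'.
rewrite mulrCA ler_pM2l ?invr_gt0// -RintegralZl//.
apply: le_Rintegral => //; first exact: integrable_scale.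
(* As [w y >= 0], it suffices to compare at a fixed [y]; there [tens b] times the kernel is a single
   nonnegative test tensor, ready for the unweighted inequality. *)
move=> y _; rewrite mulrCA ler_wpM2l//.
have [s yrs] := box_ex y.
pose bk := fun j => b j \* ker_factors (eps R n) y j.
have sbk : tsmooth bk by apply: tsmoothM => //; exact: tsmooth_ker_factors.
have rbk : tsupp bk r by exact: tsuppM.
have bkE x : tens bk x = tens b x * ker (eps R n) x y by rewrite tensM kerC.
have bk0 x : 0 <= tens bk x by rewrite bkE mulr_ge0// ker_ge0.
have := lipschitz_weak_gradient_le Hlam v wu Lu sbk rbk bk0.
under [in X in _ <= X]eq_Rintegral do rewrite bkE.
apply: le_trans; rewrite le_eqVlt; apply/orP; left; apply/eqP.
have iGk i := integrable_locally_int_tens (lGu i) sbk rbk.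
transitivity (\int[lam]_x (\sum_(i < d) v i * (Gu i x * tens bk x))).
  apply: eq_Rintegral => x _; rewrite /A mulr_suml.
  by apply: eq_bigr => i _; rewrite bkE; ring.
rewrite Rintegral_bigsum => [|i]; last exact: integrable_scale.
by apply: eq_bigr => i _; rewrite RintegralZl.
Unshelve. all: by end_near. Qed.

Variable q : E -> R.
Hypothesis cq : econtinuous q.
(** The equation of [u] written against Lebesgue measure: in the application [w] is [e^-V] and [q]
    is the centred right-hand side times [e^-V]. *)
Hypothesis weak_eq : forall (b : 'I_d -> R -> R) (r : R), tsmooth b -> tsupp b r ->
  (- \int[lam]_x ((\sum_(i < d) Gu i x * tens (dtens b i) x) * w x)) =
  \int[lam]_x (q x * tens b x).
Variables (f : E -> R) (Gf : 'I_d -> E -> R).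
Hypothesis wf : weak_gradient lam f Gf.

Let lf : locally_int lam f.
Proof. by apply: locally_integrable_locally_int; case: wf. Qed.

Let lGf i : locally_int lam (Gf i).
Proof. by apply: locally_integrable_locally_int; case: wf => _ []. Qed.

(** The Leibniz expression for the weak gradient of [f * tens c]. *)
Definition cutoff_grad (c : 'I_d -> R -> R) i x : R :=
  Gf i x * tens c x + f x * tens (dtens c i) x.

(** At a fixed scale, the mollified [q] is a divergence of the mollified field [w Gu]. Moving the
    divergence onto [f * tens c] leaves the product of [g x] with that field, to be bounded at each
    [x] in the constant direction [g x]. *)
Lemma ler_int_cutoff c (r : R) : tsmooth c -> tsupp c r ->
  (- \int[lam]_x (f x * tens c x * q x)) <=
  C * \int[lam]_x (vnorm (fun i => cutoff_grad c i x) * w x).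
Proof.
move=> sc rc; pose g := cutoff_grad c.
have lq := econtinuous_locally_int Hlam cq.
pose A x := f x * tens c x.
have iA : lam.-integrable setT (EFin \o A) by exact: integrable_locally_int_tens sc rc.
have A0 x : ~ box r x -> A x = 0 by move=> xr; rewrite /A (tens_eq0 rc xr) mulr0.
have ig i : lam.-integrable setT (EFin \o g i).
  apply: integrable_add; first exact: integrable_locally_int_tens sc rc.
  exact: integrable_locally_int_tens lf (tsmooth_dtens i sc) (tsupp_dtens i rc).
have g0 i x : ~ box r x -> g i x = 0.
  move=> xr; rewrite /g /cutoff_grad (tens_eq0 rc xr).
  by rewrite (tens_eq0 (tsupp_dtens i rc) xr) !mulr0 addr0.
pose B x := vnorm (fun i => g i x).
have iB : lam.-integrable setT (EFin \o B).
  apply: (@integrable_le _ _ _ _ _ (fun x => \sum_(i < d) `|g i x|)).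
  - by apply: measurable_vnorm => i; exact: measurable_integrable (ig i).
  - by move=> x; rewrite ger0_norm ?vnorm_ge0// vnorm_le_sum.
  - by apply: integrable_bigsum => i; exact: integrable_norm.
have B0 x : ~ box r x -> B x = 0.
  move=> xr; rewrite /B /vnorm big1 ?sqrtr0// => i _.
  by rewrite g0// expr0n.
have [_ cA] := mollify_integral_cvg Hlam iA A0 cq.
have [_ cB] := mollify_integral_cvg Hlam iB B0 cw.
(* It is enough to prove the inequality with [q] and [w] mollified at the same scale; both sides
   then carry the same factor, the inverse mass of the kernel, which cancels. *)
apply: (ler_cvg_to (cvgN cA) (cvgM (cvg_cst C) cB)); near=> n.
set e := eps R n.
have e0 : 0 < e by exact: eps_gt0.
have km := kmass_gt0 Hlam e0.
have mE D p : lam.-integrable setT (EFin \o D) -> (forall x, ~ box r x -> D x = 0) ->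
    locally_int lam p ->
    lam.-integrable setT (EFin \o (fun x => D x * \int[lam]_y (p y * ker e x y))) /\
    \int[lam]_x (D x * \int[lam]_y (p y * ker e x y)) =
    \int[lam]_y (p y * \int[lam]_x (D x * ker e x y)).
  move=> iD D0 lp.
  have [i1 _ e1] := fubini_local Hlam iD D0 lp (measurable_ker e)
    (ker_le1 e) (fun x y => ker_out (eps_itv R n)).
  by split; [exact: i1|exact: e1].
have molE D p : lam.-integrable setT (EFin \o D) -> (forall x, ~ box r x -> D x = 0) ->
    locally_int lam p -> \int[lam]_x (D x * mollify lam p n x) =
    (kmass lam e)^-1 * \int[lam]_x (D x * \int[lam]_y (p y * ker e x y)).
  move=> iD D0 lp; rewrite -RintegralZl//; last by have [] := mE D p iD D0 lp.
  by apply: eq_Rintegral => x _; rewrite /mollify mulrCA.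
suff : (- \int[lam]_x (A x * mollify lam q n x)) <=
    C * \int[lam]_x (B x * mollify lam w n x) by [].
rewrite molE// molE// -mulrN [leRHS]mulrCA ler_pM2l ?invr_gt0//.
pose X i y := Gu i y * w y.
have lX i : locally_int lam (X i) by exact: locally_intM.
have dE i x : \int[lam]_y (X i y * dker e i x y) =
    - \int[lam]_y (Gu i y * tens (dtens (ker_factors e x) i) y * w y).
  have [s xs] := box_ex x.
  rewrite -[RHS]mulN1r -RintegralZl//.
    by apply: eq_Rintegral => y _; rewrite dkerN /X; ring.
  have := integrable_locally_int_tens (lX i) (tsmooth_dtens i (tsmooth_ker_factors e x))
    (tsupp_dtens i (tsupp_ker_factors e0 xs)).
  by apply: eq_integrable => // y _; rewrite /= /X mulrAC.
(* The equation of [u] tested with [ker e x] in the variable [y]; the minus sign of the weak form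
   and the one of [dkerN] compensate. *)
have qE x : \int[lam]_y (q y * ker e x y) = \sum_(i < d) \int[lam]_y (X i y * dker e i x y).
  have [s xs] := box_ex x.
  rewrite -(weak_eq (tsmooth_ker_factors e x) (tsupp_ker_factors e0 xs)).
  rewrite -Rintegral_bigsum => [|i].
    rewrite -mulN1r -RintegralZl//.
      apply: eq_Rintegral => y _; rewrite mulr_suml mulr_sumr.
      by apply: eq_bigr => i _; rewrite dkerN /X; ring.
    rewrite (_ : _ \o _ = EFin \o (fun y => \sum_(i < d) X i y *
        tens (dtens (ker_factors e x) i) y)); last first.
      apply/funext => y; rewrite /= mulr_suml; congr EFin.
      by apply: eq_bigr => i _; rewrite /X mulrAC.
    apply: integrable_bigsum => i.
    exact: integrable_locally_int_tens (lX i) (tsmooth_dtens i (tsmooth_ker_factors e x))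
      (tsupp_dtens i (tsupp_ker_factors e0 xs)).
  have := integrable_scale (-1) (integrable_locally_int_tens (lX i)
    (tsmooth_dtens i (tsmooth_ker_factors e x)) (tsupp_dtens i (tsupp_ker_factors e0 xs))).
  by apply: eq_integrable => // y _; rewrite /= dkerN; congr EFin; ring.
(* The weak gradient of [f] tested with [tens c] times the kernel centred at [y]. In the Leibniz
   rule, the term where [tens c] is differentiated joins [Gf] to form [g]. *)
have AE i y : \int[lam]_x (A x * dker e i x y) = - \int[lam]_x (g i x * ker e x y).
  pose ck := fun j => c j \* ker_factors e y j.
  have sck : tsmooth ck by apply: tsmoothM => //; exact: tsmooth_ker_factors.
  have rck : tsupp ck r by exact: tsuppM.
  have := weak_gradient_tens i wf sck rck.
  have ckE x : tens (dtens ck i) x =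
      tens (dtens c i) x * ker e x y + tens c x * dker e i x y.
    rewrite -pd_tens// pd_tensM//; last exact: tsmooth_ker_factors.
    by rewrite -/(ker e y x) kerC.
  have mker : measurable_fun setT (fun x => ker e x y).
    rewrite (_ : (fun x => _) = ker e y); last by apply/funext => x; exact: kerC.
    apply: econtinuous_measurable; apply: econtinuous_tens.
    exact: tsmooth_ker_factors.
  have i1 : lam.-integrable setT (EFin \o (fun x => f x * tens (dtens c i) x * ker e x y)).
    apply: (@integrable_mul_bounded _ _ _ _ _ (fun x => ker e x y) 1).
    - exact: integrable_locally_int_tens lf (tsmooth_dtens i sc) (tsupp_dtens i rc).
    - exact: mker.
    - by move=> x; exact: ker_le1.
  have [M _ /(_ e i) HM] := @dker_bounded R d.
  have i2 : lam.-integrable setT (EFin \o (fun x => A x * dker e i x y)).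
    apply: (@integrable_mul_bounded _ _ _ _ _ (fun x => dker e i x y) (`|e^-1| * M)) => //.
    apply: econtinuous_measurable; apply: econtinuous_tens.
    exact: tsmooth_dtens (tsmooth_ker_factors e y).
  have i3 : lam.-integrable setT (EFin \o (fun x => Gf i x * tens c x * ker e x y)).
    apply: (@integrable_mul_bounded _ _ _ _ _ (fun x => ker e x y) 1).
    - exact: integrable_locally_int_tens (lGf i) sc rc.
    - exact: mker.
    - by move=> x; exact: ker_le1.
  rewrite (_ : \int[lam]_x (f x * _) = \int[lam]_x (f x * tens (dtens c i) x * ker e x y) +
      \int[lam]_x (A x * dker e i x y)); last first.
    by rewrite -RintegralD//; apply: eq_Rintegral => x _; rewrite ckE /A; ring.
  rewrite (_ : \int[lam]_x (Gf i x * _) = \int[lam]_x (Gf i x * tens c x * ker e x y)); last first.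
    by apply: eq_Rintegral => x _; rewrite tensM -/(ker e y x) kerC mulrA.
  rewrite (_ : \int[lam]_x (g i x * _) = \int[lam]_x (Gf i x * tens c x * ker e x y) +
      \int[lam]_x (f x * tens (dtens c i) x * ker e x y)); last first.
    by rewrite -RintegralD//; apply: eq_Rintegral => x _; rewrite /g /cutoff_grad; ring.
  by lra.
(* Fubini is used in both directions: once to bring the integral over [x] inside, where [AE]
   applies, and once to return with [ker] in place of [dker]. *)
have AqE : \int[lam]_x (A x * \int[lam]_y (q y * ker e x y)) =
    - \int[lam]_x (\sum_(i < d) g i x * \int[lam]_y (X i y * ker e x y)).
  have fd i : lam.-integrable setT
      (EFin \o (fun x => A x * \int[lam]_y (X i y * dker e i x y))) /\
      \int[lam]_x (A x * \int[lam]_y (X i y * dker e i x y)) =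
      - \int[lam]_x (g i x * \int[lam]_y (X i y * ker e x y)).
    have [M _ /(_ e i) HM] := @dker_bounded R d.
    have [i1 _ e1] := fubini_local Hlam iA A0 (lX i) (measurable_dker e i)
      HM (fun x y => dker_out i (eps_itv R n)).
    split; first exact: i1.
    rewrite [LHS]e1 (mE _ _ (ig i) (g0 i) (lX i)).2.
    have [_ i2 _] := fubini_local Hlam (ig i) (g0 i) (lX i) (measurable_ker e)
      (ker_le1 e) (fun x y => ker_out (eps_itv R n)).
    rewrite -[RHS]mulN1r -RintegralZl//; apply: eq_Rintegral => y _.
    by rewrite /= AE; ring.
  rewrite Rintegral_bigsum => [|i]; last exact: (mE _ _ (ig i) (g0 i) (lX i)).1.
  rewrite -sumrN.
  under [RHS]eq_bigr do rewrite -(fd _).2.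
  rewrite -Rintegral_bigsum => [|i]; last exact: (fd i).1.
  by apply: eq_Rintegral => x _; rewrite qE mulr_sumr.
rewrite AqE opprK -RintegralZl//; last exact: (mE _ _ iB B0 lw).1.
apply: le_Rintegral => //.
- by apply: integrable_bigsum => i; exact: (mE _ _ (ig i) (g0 i) (lX i)).1.
- apply: integrable_scale; exact: (mE _ _ iB B0 lw).1.
move=> x _; have [s xs] := box_ex x.
(* The direction is [g] at the outer point [x], a constant for the inner integral over [y], and the
   kernel itself is the nonnegative test tensor. *)
have := lipschitz_weak_gradient_weight_le (fun i => g i x)
  (tsmooth_ker_factors e x) (tsupp_ker_factors e0 xs) (ker_ge0 e x).
rewrite -[leRHS]mulrA /B.
rewrite (_ : \int[lam]_x0 (w x0 * _) = \int[lam]_y (tens (ker_factors e x) y * w y)); last first.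
  by apply: eq_Rintegral => y _; rewrite mulrC.
apply: le_trans; rewrite le_eqVlt; apply/orP; left; apply/eqP.
apply: eq_bigr => i _; congr (_ * _); apply: eq_Rintegral => y _.
by rewrite /X /ker mulrAC.
Unshelve. all: by end_near. Qed.

End weighted_inequality.

(** * Removal of the cutoff *)

Section cutoff_limit.
Variables (R : realType) (d : nat).
Local Notation E := (d.-tuple R).
Variable lam : {measure set E -> \bar R}.
Hypothesis Hlam : is_lebesgue lam.
Variables (w q u f : E -> R) (Gu Gf : 'I_d -> E -> R) (C : R).
Hypothesis cw : econtinuous w.
Hypothesis w0 : forall x, 0 <= w x.
Hypothesis wu : weak_gradient lam u Gu.
Hypothesis Lu : lipschitz_with C u.
Hypothesis cq : econtinuous q.
Hypothesis weak_eq : forall (b : 'I_d -> R -> R) (r : R),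
  tsmooth b -> tsupp b r ->
  (- \int[lam]_x ((\sum_(i < d) Gu i x * tens (dtens b i) x) * w x)) =
  \int[lam]_x (q x * tens b x).
Hypothesis wf : weak_gradient lam f Gf.
Hypothesis ifq : lam.-integrable setT (EFin \o (fun x => f x * q x)).
Hypothesis ifw : lam.-integrable setT (EFin \o (fun x => f x * w x)).
Hypothesis igw : lam.-integrable setT
  (EFin \o (fun x => vnorm (fun i => Gf i x) * w x)).

(** The cutoffs are kernels centred at the origin at scale [n+1], so their bounds are those of the
    kernel. The term where the cutoff is differentiated is at most a multiple of [|f| w / (n+1)] and
    disappears because [f w] is integrable. *)
Lemma ler_int_vnorm : (- \int[lam]_x (f x * q x)) <=
  C * \int[lam]_x (vnorm (fun i => Gf i x) * w x).
Proof.
pose o : E := [tuple 0 | _ < d].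
pose c n := ker_factors n.+1%:R o : 'I_d -> R -> R.
have n0 n : 0 < n.+1%:R :> R by rewrite ltr0n.
have bo : box 0 o by move=> i; rewrite tnth_mktuple normr0.
have sc n : tsmooth (c n) by exact: tsmooth_ker_factors.
have rc n : tsupp (c n) (0 + n.+1%:R) by exact: tsupp_ker_factors.
have cE n j t : c n j t = bump (t / n.+1%:R).
  by rewrite /c /ker_factors tnth_mktuple mulr0 subr0 mulrC.
(* The cutoffs converge pointwise to [beta], not to 1. Both sides of the limit inequality are
   homogeneous in it, so its positivity suffices to cancel it. *)
pose beta : R := \prod_(j < d) bump 0.
have beta0 : 0 < beta.
  apply: prodr_gt0 => j _; apply: (lt_le_trans _ (bump_ge_half _)).
    by rewrite mulr_gt0 ?expR_gt0.
  by rewrite normr0 divr_ge0.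
have inv0 (t : R) : t / n.+1%:R @[n --> \oo] --> (0 : R).
  by rewrite -[X in _ --> X](mulr0 t); apply: cvgM; [exact: cvg_cst|exact: cvg_harmonic].
have cbeta x : tens (c n) x @[n --> \oo] --> beta.
  apply: cvg_big => [|j _]; first exact: mul_continuous.
  under eq_fun do rewrite cE.
  apply: (continuous_cvg _ _ (inv0 (tnth x j))).
  by apply: smooth1_continuous; exact: smooth1_bump.
have [M M0 HM] := @dker_bounded R d.
have dcle n i x : `|tens (dtens (c n) i) x| <= n.+1%:R^-1 * M.
  by have := HM n.+1%:R i x o; rewrite [`|_^-1|]ger0_norm.
have mf : measurable_fun setT f.
  apply: (@measurable_locally_int _ _ lam).
  by apply: locally_integrable_locally_int; case: wf.
have mGf i : measurable_fun setT (Gf i).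
  apply: (@measurable_locally_int _ _ lam).
  by apply: locally_integrable_locally_int; case: wf => _ [].
have mw : measurable_fun setT w by exact: econtinuous_measurable.
have mt b : tsmooth b -> measurable_fun setT (tens b : E -> R).
  by move=> sb; apply: econtinuous_measurable; exact: econtinuous_tens.
have [_ c1] : lam.-integrable setT (EFin \o (fun x => f x * beta * q x)) /\
    \int[lam]_x (f x * tens (c n) x * q x) @[n --> \oo] -->
    \int[lam]_x (f x * beta * q x).
  apply: (dominated_Rintegral (H := fun x => `|f x * q x|)).
  - move=> n; apply: measurable_funM; last exact: econtinuous_measurable.
    by apply: measurable_funM => //; exact: mt.
  - move=> x; apply: cvgM; last exact: cvg_cst.
    by apply: cvgM; [exact: cvg_cst|exact: cbeta].
  - exact: integrable_norm.
  - move=> n x; rewrite mulrAC normrM ler_piMr//; exact: ker_le1.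
have [_ c2] : lam.-integrable setT
      (EFin \o (fun x => vnorm (fun i => beta * Gf i x) * w x)) /\
    \int[lam]_x (vnorm (fun i => cutoff_grad f Gf (c n) i x) * w x) @[n --> \oo] -->
    \int[lam]_x (vnorm (fun i => beta * Gf i x) * w x).
  (* The norm is at most the sum of its components; in each, [|Gf i|] is bounded by the norm of
     [Gf], and the factor [1/(n+1)] of the second term by 1. *)
  apply: (dominated_Rintegral (H := fun x =>
    \sum_(i < d) (vnorm (fun i => Gf i x) * w x + M * `|f x * w x|))).
  - move=> n; apply: measurable_funM => //; apply: measurable_vnorm => i.
    apply: measurable_funD; apply: measurable_funM => //; apply: mt => //.
    exact: tsmooth_dtens.
  - move=> x; apply: cvgM; last exact: cvg_cst.
    apply: continuous_cvg; first exact: sqrt_continuous.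
    apply: cvg_big => [|i _]; first exact: add_continuous.
    suff : cutoff_grad f Gf (c n) i x @[n --> \oo] --> beta * Gf i x.
      by move=> H; exact: (cvgM H H).
    rewrite -[beta * _]addr0 -[X in _ + X](mulr0 (f x)) [beta * _]mulrC.
    apply: cvgD; apply: cvgM; do ?[exact: cvg_cst|exact: cbeta].
    apply/cvgrPdist_le => e e0; have /cvgr0Pnorm_le/(_ e e0) := inv0 M.
    apply: filterS => n; apply: le_trans.
    by rewrite sub0r normrN (le_trans (dcle n i x))// mulrC ler_norm.
  - apply: integrable_bigsum => i; apply: integrable_add => //.
    by apply: integrable_scale; exact: integrable_norm.
  - move=> n x; rewrite normrM [`|w x|]ger0_norm// ger0_norm ?vnorm_ge0//.
    apply: (le_trans (ler_wpM2r (w0 x) (vnorm_le_sum _))).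
    rewrite mulr_suml; apply: ler_sum => i _.
    rewrite [`|f x * _|]normrM [`|w x|]ger0_norm// mulrA -mulrDl ler_wpM2r//.
    rewrite (le_trans (ler_normD _ _))// !normrM lerD//.
      rewrite -[leRHS]mulr1 ler_pM// ?ker_le1//.
      exact: (ler_vnorm (fun i => Gf i x)).
    rewrite mulrC ler_wpM2r// (le_trans (dcle n i x))// ler_piMl//.
    by rewrite invf_le1// ler1n.
have := ler_cvg_to (cvgN c1) (cvgM (cvg_cst C) c2).
have -> : \int[lam]_x (f x * beta * q x) = beta * \int[lam]_x (f x * q x).
  by rewrite -RintegralZl//; apply: eq_Rintegral => x _; ring.
have -> : \int[lam]_x (vnorm (fun i => beta * Gf i x) * w x) =
    beta * \int[lam]_x (vnorm (fun i => Gf i x) * w x).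
  rewrite -RintegralZl//; apply: eq_Rintegral => x _.
  by rewrite vnormZ gtr0_norm// mulrA.
rewrite -mulrN mulrCA ler_pM2l//; apply; near=> n.
exact: (ler_int_cutoff Hlam cw w0 wu Lu cq weak_eq wf (sc n) (rc n)).
Unshelve. all: by end_near. Qed.

End cutoff_limit.

Theorem theorem2 (R : realType) (d : nat)
  (lam : {measure set (d.-tuple R) -> \bar R})
  (mu : {measure set (d.-tuple R) -> \bar R})
  (V : d.-tuple R -> R) (C : R) :
  is_lebesgue lam ->
  Ck 2 V ->
  (forall A, measurable A -> (mu A = \int[lam]_(x in A) (expR (- V x))%:E)%E) ->
  (\int[lam]_x (expR (- V x))%:E = 1)%E ->
  0 < C -> CLipLip_const lam mu C ->
  forall (f : d.-tuple R -> R) (Gf : 'I_d -> d.-tuple R -> R)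
         (nu : {measure set (d.-tuple R) -> \bar R}),
    (forall x, 0 <= f x) ->
    measurable_fun setT f ->
    weak_gradient lam f Gf ->
    (\int[mu]_x (f x)%:E = 1)%E ->
    (forall A, measurable A -> (nu A = \int[mu]_(x in A) (f x)%:E)%E) ->
    (W1 mu nu <= C%:E * \int[mu]_x (vnorm (fun i => Gf i x))%:E)%E.
Proof.
move=> Hlam CV muE _ C0 HC f Gf nu f0 mf wf f1 nuE.
pose w x := expR (- V x).
have cw : econtinuous w.
  have cV : econtinuous V := (CV [::] isT).1.
  apply: (econtinuous_comp (g := fun t => expR (- t))) => // t.
  apply: continuous_comp; [exact: continuousN|exact: continuous_expR].
have w0 x : 0 <= w x by exact: expR_ge0.
have mw := econtinuous_measurable cw.
have mGf i : measurable_fun setT (Gf i).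
  apply: (@measurable_locally_int _ _ lam).
  by apply: locally_integrable_locally_int; case: wf => _ [].
have mvn := measurable_vnorm mGf.
(* If the gradient is not integrable, [C > 0] makes the right-hand side infinite; afterwards all
   integrals are real numbers. *)
have [ninf|] := eqVneq (\int[mu]_x (vnorm (fun i => Gf i x))%:E)%E +oo%E.
  by rewrite ninf gt0_muley ?leey// lte_fin.
rewrite -ltey => fin.
have iG : mu.-integrable setT (EFin \o (fun x => vnorm (fun i => Gf i x))).
  apply/integrableP; split; first exact/measurable_EFinP.
  by under eq_integral do rewrite /= ger0_norm ?vnorm_ge0//.
have ifm : mu.-integrable setT (EFin \o f).
  apply/integrableP; split; first exact/measurable_EFinP.
  under eq_integral do rewrite /= ger0_norm//.
  by rewrite f1 ltry.
have iGw := (integrable_density w0 mw muE mvn).1 iG.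
have ifw := (integrable_density w0 mw muE mf).1 ifm.
apply: ge_ereal_sup => _ [h [h1 [ihm ihn]] <-].
have ch := lipschitz_econtinuous h1.
have mh := econtinuous_measurable ch.
have mhf : measurable_fun setT (fun x => h x * f x) by exact: measurable_funM.
(* Two changes of density, from [nu] to [mu] and from [mu] to Lebesgue measure, make [h f w]
   integrable. *)
have ihf := (integrable_density f0 mf nuE mh).1 ihn.
have ihfw := (integrable_density w0 mw muE mhf).1 ihf.
have [u [Lu [Gu [wu weq]]]] := HC 1 h ler01 h1 ihm.
rewrite mulr1 in Lu.
set m := fine _ in weq.
pose q x := (h x - m) * w x.
have cq : econtinuous q.
  by apply: econtinuousM => //; apply: econtinuousB => //; exact: econtinuous_cst.
have mGu i : measurable_fun setT (Gu i).
  apply: (@measurable_locally_int _ _ lam).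
  by apply: locally_integrable_locally_int; case: wu => _ [].
have mt b : tsmooth b -> measurable_fun setT (tens b : d.-tuple R -> R).
  by move=> sb; apply: econtinuous_measurable; exact: econtinuous_tens.
have weak_eq (b : 'I_d -> R -> R) (r : R) : tsmooth b -> tsupp b r ->
    (- \int[lam]_x ((\sum_(i < d) Gu i x * tens (dtens b i) x) * w x)) =
    \int[lam]_x (q x * tens b x).
  move=> sb rb; rewrite -(Rintegral_density w0 mw muE); last first.
    apply: measurable_sum => i; apply: measurable_funM => //.
    by apply: mt; exact: tsmooth_dtens.
  rewrite (_ : \int[lam]_x _ = \int[lam]_x ((h x - m) * tens b x * w x)); last first.
    by apply: eq_Rintegral => x _; rewrite /q mulrAC.
  rewrite -(Rintegral_density w0 mw muE); last first.
    by apply: measurable_funM; [exact: measurable_funB|exact: mt].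
  have := weq _ (test_fun_tens sb rb).
  under eq_integral do under eq_bigr do rewrite pd_tens//.
  by rewrite /Rintegral => <-; rewrite fineN.
have mE : \int[mu]_x h x = m by [].
have fE : \int[lam]_x (f x * w x) = 1.
  by rewrite -(Rintegral_density w0 mw muE)// /Rintegral f1.
have nE : \int[nu]_x h x = \int[lam]_x (h x * f x * w x).
  by rewrite (Rintegral_density f0 mf nuE)// (Rintegral_density w0 mw muE).
(* Since [f] has mass 1 under [mu], integrating this identity gives [\int h dnu - m], and the
   negative of that is exactly the quantity inside the supremum. *)
have fqE : (fun x => f x * q x) =
    (fun x => h x * f x * w x - m * (f x * w x)).
  by apply/funext => x; rewrite /q; ring.
have ifq : lam.-integrable setT (EFin \o (fun x => f x * q x)).
  rewrite fqE.
  exact: (integrableB measurableT ihfw (integrable_scale m ifw)).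
have := ler_int_vnorm Hlam cw w0 wu Lu cq weak_eq wf ifq ifw iGw.
rewrite fqE RintegralB//; last exact: integrable_scale.
rewrite RintegralZl// fE mulr1 opprB -nE -(Rintegral_density w0 mw muE)//.
by rewrite -!EFin_Rintegral// -EFinB -EFinM lee_fin mE.
Qed.
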